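(* Let $G$ be a finite group that has an AI-automorphism. Then there is a central extension $$1\to H_2(G,\mathbb{Z})\to\tau(G)\to K(G,3)\to 1.$$
   Context: Conventions: $[g,h]=g^{-1}h^{-1}gh$, $g^h=h^{-1}gh$, and $G'$ is the commutator subgroup. Let $G^\ast$ be an isomorphic copy of $G$ via $g\mapsto g^\ast$, and let $G\star G^\ast$ be the free product. The group $\nu(G)$ is the quotient of $G\star G^\ast$ by the normal closure of all elements $[x,y^\ast]^z[x^z,(y^z)^\ast]^{-1}$ and $[x,y^\ast]^{(z^\ast)}[x^z,(y^z)^\ast]^{-1}$ with $x,y,z\in G$. Put $\nabla(G)=\langle [x,x^\ast]: x\in G\rangle\leq \nu(G)$ and $\tau(G)=\nu(G)/\nabla(G)$. $K(G,n)=\{(g_1,\ldots,g_n)\in G^n: g_1\cdots g_n\in G'\}$. An AI-automorphism of $G$ is an automorphism of $G$ that induces the inversion automorphism on the abelianisation $G/G'$. *)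

(* Defs.v *)
From HB Require Import structures.
From mathcomp Require Import all_boot all_order all_fingroup all_algebra all_solvable.
From mathcomp Require Import boolp.

Set Implicit Arguments.
Unset Strict Implicit.
Unset Printing Implicit Defensive.

Import GRing.Theory.
Import GroupScope.

Local Notation qrepr := generic_quotient.repr.

Inductive genp (G : groupType) (S : G -> Prop) : G -> Prop :=
| genp_in x : S x -> genp S x
| genp_1 : genp S 1
| genp_M x y : genp S x -> genp S y -> genp S (x * y)
| genp_V x : genp S x -> genp S x^-1.

Definition gengroup (G : groupType) (S : G -> Prop) : {pred G} :=
  fun x => `[< genp S x >].

Lemma gengroupP (G : groupType) (S : G -> Prop) x :
  reflect (genp S x) (x \in gengroup S).
Proof. exact: asboolP. Qed.

Section GenGroupClosed.
Variables (G : groupType) (S : G -> Prop).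

Fact gengroup_mulg_closed : mulg_closed (gengroup S).
Proof.
by move=> x y /gengroupP Sx /gengroupP Sy; apply/gengroupP/genp_M.
Qed.

Fact gengroup1 : 1 \in gengroup S.
Proof. exact/gengroupP/genp_1. Qed.

Fact gengroup_invg_closed : invg_closed (gengroup S).
Proof. by move=> x /gengroupP Sx; apply/gengroupP/genp_V. Qed.

HB.instance Definition _ := isMulClosed.Build G (gengroup S) gengroup_mulg_closed.
HB.instance Definition _ := isMul1Closed.Build G (gengroup S) gengroup1.
HB.instance Definition _ := isInvClosed.Build G (gengroup S) gengroup_invg_closed.
End GenGroupClosed.

HB.mixin Record isConjClosed (G : groupType) (S : {pred G}) := {
  gpredJ : forall x y, x \in S -> x ^ y \in S
}.

#[short(type="normalClosed")]
HB.structure Definition NormalClosed (G : groupType) :=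
  {S of isConjClosed G S & GroupClosed G S}.

Lemma gengroupJ (G : groupType) (S : G -> Prop) :
  (forall x y, S x -> S (x ^ y)) ->
  forall x y, x \in gengroup S -> x ^ y \in gengroup S.
Proof.
move=> SJ x y /gengroupP Sx; apply/gengroupP.
elim: Sx => {x} [x /(SJ _ y)|| x z _ Sx _ Sz | x _ Sx].
- exact: genp_in.
- by rewrite conj1g; apply: genp_1.
- by rewrite conjMg; apply: genp_M.
- by rewrite conjVg; apply: genp_V.
Qed.

Definition conjugates (G : groupType) (S : G -> Prop) (r : G) : Prop :=
  exists x z : G, S x /\ r = x ^ z.

Definition nclosure (G : groupType) (S : G -> Prop) : {pred G} :=
  gengroup (conjugates S).

Section NormalClosure.
Variables (G : groupType) (S : G -> Prop).

Fact nclosureJ x y : x \in nclosure S -> x ^ y \in nclosure S.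
Proof.
by apply: gengroupJ => _ z [a [b [Sa ->]]]; exists a, (b * z); rewrite conjgM.
Qed.

HB.instance Definition _ := GroupClosed.on (nclosure S).
HB.instance Definition _ := isConjClosed.Build G (nclosure S) nclosureJ.
End NormalClosure.

Section GroupQuotient.
Variables (G : groupType) (N : normalClosed G).
Local Open Scope quotient_scope.

Definition coset_equiv (x y : G) := x^-1 * y \in N.

Fact coset_equiv_is_equiv : equiv_class_of coset_equiv.
Proof.
rewrite /coset_equiv; split=> [x|x y|y x z].
- by rewrite mulVg gpred1.
- by apply/idP/idP=> /gpredVr; rewrite invgM invgK.
- by move=> Nxy Nyz; rewrite -[x^-1](mulgK y) -mulgA gpredM.
Qed.

Canonical coset_equiv_rel := EquivRelPack coset_equiv_is_equiv.
Canonical coset_encModRel := defaultEncModRel coset_equiv.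

Definition quotg := {eq_quot coset_equiv}.

HB.instance Definition _ : EqQuotient G coset_equiv quotg := EqQuotient.on quotg.
HB.instance Definition _ := Choice.on quotg.

Lemma quotg_eqE (x y : G) : (x == y %[mod quotg]) = (x^-1 * y \in N).
Proof. by rewrite piE. Qed.

Definition quotg_one : quotg := lift_cst quotg 1.
Definition quotg_mul := lift_op2 quotg *%g.
Definition quotg_inv := lift_op1 quotg (fun x : G => x^-1).

Fact quotg_oneE : quotg_one = \pi_quotg 1.
Proof. by unlock quotg_one. Qed.

Fact quotg_mulE x y : quotg_mul (\pi_quotg x) (\pi_quotg y) = \pi_quotg (x * y).
Proof.
unlock quotg_mul; apply/eqP; rewrite quotg_eqE.
have: (qrepr (\pi_quotg x))^-1 * x \in N by rewrite -quotg_eqE reprK.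
have: (qrepr (\pi_quotg y))^-1 * y \in N by rewrite -quotg_eqE reprK.
move: (qrepr (\pi_quotg x)) (qrepr (\pi_quotg y)) => x' y' Ny Nx.
suff -> : (x' * y')^-1 * (x * y) = (x'^-1 * x) ^ y' * (y'^-1 * y).
  by rewrite gpredM // gpredJ.
by rewrite conjgE invgM !mulgA mulgK.
Qed.

Fact quotg_invE x : quotg_inv (\pi_quotg x) = \pi_quotg x^-1.
Proof.
unlock quotg_inv; apply/eqP; rewrite quotg_eqE.
have: (qrepr (\pi_quotg x))^-1 * x \in N by rewrite -quotg_eqE reprK.
move: (qrepr _) => x' /gpredVr Nx.
suff -> : x'^-1^-1 * x^-1 = ((x'^-1 * x)^-1) ^ x'^-1 by apply: gpredJ.
by rewrite conjgE invgM !invgK !mulgA mulgK.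
Qed.

Fact quotg_mulA : associative quotg_mul.
Proof.
by move=> a b c; rewrite -[a]reprK -[b]reprK -[c]reprK !quotg_mulE mulgA.
Qed.

Fact quotg_mul1 : left_id quotg_one quotg_mul.
Proof. by move=> a; rewrite -[a]reprK quotg_oneE quotg_mulE mul1g. Qed.

Fact quotg_mul1r : right_id quotg_one quotg_mul.
Proof. by move=> a; rewrite -[a]reprK quotg_oneE quotg_mulE mulg1. Qed.

Fact quotg_mulV : left_inverse quotg_one quotg_inv quotg_mul.
Proof. by move=> a; rewrite -[a]reprK quotg_oneE quotg_invE quotg_mulE mulVg. Qed.

Fact quotg_mulVr : right_inverse quotg_one quotg_inv quotg_mul.
Proof. by move=> a; rewrite -[a]reprK quotg_oneE quotg_invE quotg_mulE mulgV. Qed.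

HB.instance Definition _ := isGroup.Build quotg
  quotg_mulA quotg_mul1 quotg_mul1r quotg_mulV quotg_mulVr.

Definition qproj (g : G) : quotg := \pi_quotg g.

Lemma qprojM : {morph qproj : x y / x * y}.
Proof. by move=> x y; rewrite /qproj -quotg_mulE. Qed.

Fact qproj_gmulfF : {morph qproj : x y / x * y^-1}.
Proof. by move=> x y; rewrite qprojM; congr (_ * _); rewrite /qproj -quotg_invE. Qed.

HB.instance Definition _ := isGroupMorphism.Build G quotg qproj qproj_gmulfF.

Lemma qproj_eq (x y : G) : (qproj x == qproj y) = (x^-1 * y \in N).
Proof. exact: quotg_eqE. Qed.

Lemma qproj_surj (a : quotg) : exists x, a = qproj x.
Proof. by exists (qrepr a); rewrite /qproj reprK. Qed.

End GroupQuotient.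

Arguments qproj {G} N g.

Section FreeProduct.
Variables G H : groupType.
Local Open Scope quotient_scope.

Definition fpword : Type := seq (G + H).
HB.instance Definition _ := Choice.on fpword.

(* The smallest congruence on the free monoid on [G + H] for which [inl] and  *)
(* [inr] become monoid morphisms.                                             *)
Inductive fpcongr : fpword -> fpword -> Prop :=
| fpcongr_refl s : fpcongr s s
| fpcongr_sym s t : fpcongr s t -> fpcongr t s
| fpcongr_trans s t u : fpcongr s t -> fpcongr t u -> fpcongr s u
| fpcongr_cat s s' t t' :
    fpcongr s s' -> fpcongr t t' -> fpcongr (s ++ t) (s' ++ t')
| fpcongr_l1 : fpcongr [:: inl 1] [::]
| fpcongr_r1 : fpcongr [:: inr 1] [::]
| fpcongr_lM x y : fpcongr [:: inl x; inl y] [:: inl (x * y)]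
| fpcongr_rM x y : fpcongr [:: inr x; inr y] [:: inr (x * y)].

Definition fpequiv (s t : fpword) := `[< fpcongr s t >].

Fact fpequiv_is_equiv : equiv_class_of fpequiv.
Proof.
split=> [s|s t|t s u].
- exact/asboolP/fpcongr_refl.
- by apply/asboolP/asboolP; apply: fpcongr_sym.
- by move=> /asboolP st /asboolP tu; apply/asboolP/(fpcongr_trans st tu).
Qed.

Canonical fpequiv_rel := EquivRelPack fpequiv_is_equiv.
Canonical fp_encModRel := defaultEncModRel fpequiv.

Definition freeprod := {eq_quot fpequiv}.

HB.instance Definition _ : EqQuotient fpword fpequiv freeprod := EqQuotient.on freeprod.
HB.instance Definition _ := Choice.on freeprod.

Lemma freeprod_eqP (s t : fpword) : (s = t %[mod freeprod]) <-> fpcongr s t.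
Proof. by split=> [/eqP|st]; [rewrite piE => /asboolP | apply/eqP; rewrite piE; apply/asboolP]. Qed.

Definition fpletterV (l : G + H) : G + H :=
  match l with inl x => inl x^-1 | inr x => inr x^-1 end.
Definition fpwordV (s : fpword) : fpword := rev (map fpletterV s).

Definition freeprod_one : freeprod := lift_cst freeprod ([::] : fpword).
Definition freeprod_mul := lift_op2 freeprod (cat : fpword -> fpword -> fpword).
Definition freeprod_inv := lift_op1 freeprod fpwordV.

Fact fpcongrV s t : fpcongr s t -> fpcongr (fpwordV s) (fpwordV t).
Proof.
elim=> {s t} [s|s t _|s t u _ st _|s s' t t' _ ss' _ tt'|||x y|x y].
- exact: fpcongr_refl.
- exact: fpcongr_sym.
- exact: fpcongr_trans st.
- by rewrite /fpwordV !map_cat !rev_cat; apply: fpcongr_cat.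
- by rewrite /fpwordV /= invg1; apply: fpcongr_l1.
- by rewrite /fpwordV /= invg1; apply: fpcongr_r1.
- by rewrite /fpwordV /= invgM; apply: fpcongr_lM.
- by rewrite /fpwordV /= invgM; apply: fpcongr_rM.
Qed.

Fact fpcongr_repr (s : fpword) : fpcongr (qrepr (\pi_freeprod s)) s.
Proof. by apply/freeprod_eqP; rewrite reprK. Qed.

Fact freeprod_oneE : freeprod_one = \pi_freeprod [::].
Proof. by unlock freeprod_one. Qed.

Fact freeprod_mulE s t : freeprod_mul (\pi_freeprod s) (\pi_freeprod t) = \pi_freeprod (s ++ t).
Proof. by unlock freeprod_mul; apply/freeprod_eqP/fpcongr_cat; apply: fpcongr_repr. Qed.

Fact freeprod_invE s : freeprod_inv (\pi_freeprod s) = \pi_freeprod (fpwordV s).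
Proof. by unlock freeprod_inv; exact/freeprod_eqP/fpcongrV/fpcongr_repr. Qed.

Fact fpwordVK : involutive fpwordV.
Proof.
move=> s; rewrite /fpwordV map_rev revK -map_comp map_id_in // => -[] x _ /=;
by rewrite invgK.
Qed.

Fact fpcongr_mulV s : fpcongr (fpwordV s ++ s) [::].
Proof.
elim: s => [|l s IHs]; first exact: fpcongr_refl.
have /fpcongr_trans: fpcongr (fpwordV s ++ ([:: fpletterV l; l] ++ s))
    (fpwordV s ++ ([::] ++ s)).
  apply/fpcongr_cat; first exact: fpcongr_refl.
  apply/fpcongr_cat; last exact: fpcongr_refl.
  case: l => x /=.
    by apply/(fpcongr_trans (fpcongr_lM _ _)); rewrite mulVg; apply: fpcongr_l1.
  by apply/(fpcongr_trans (fpcongr_rM _ _)); rewrite mulVg; apply: fpcongr_r1.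
by move=> /(_ _ IHs); rewrite /fpwordV /= rev_cons cat_rcons.
Qed.

Fact freeprod_mulA : associative freeprod_mul.
Proof.
by move=> a b c; rewrite -[a]reprK -[b]reprK -[c]reprK !freeprod_mulE catA.
Qed.

Fact freeprod_mul1 : left_id freeprod_one freeprod_mul.
Proof. by move=> a; rewrite -[a]reprK freeprod_oneE freeprod_mulE. Qed.

Fact freeprod_mul1r : right_id freeprod_one freeprod_mul.
Proof. by move=> a; rewrite -[a]reprK freeprod_oneE freeprod_mulE cats0. Qed.

Fact freeprod_mulV : left_inverse freeprod_one freeprod_inv freeprod_mul.
Proof.
move=> a; rewrite -[a]reprK freeprod_oneE freeprod_invE freeprod_mulE.
exact/freeprod_eqP/fpcongr_mulV.
Qed.

Fact freeprod_mulVr : right_inverse freeprod_one freeprod_inv freeprod_mul.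
Proof.
move=> a; rewrite -[a]reprK freeprod_oneE freeprod_invE freeprod_mulE.
by apply/freeprod_eqP; rewrite -{1}[qrepr a]fpwordVK; apply: fpcongr_mulV.
Qed.

HB.instance Definition _ := isGroup.Build freeprod
  freeprod_mulA freeprod_mul1 freeprod_mul1r freeprod_mulV freeprod_mulVr.

Definition fpl (x : G) : freeprod := \pi_freeprod [:: inl x].
Definition fpr (x : H) : freeprod := \pi_freeprod [:: inr x].

Fact fpl_gmulfF : {morph fpl : x y / x * y^-1}.
Proof.
move=> x y; rewrite /fpl -[RHS]/(freeprod_mul _ (freeprod_inv _)) freeprod_invE freeprod_mulE.
exact/freeprod_eqP/fpcongr_sym/fpcongr_lM.
Qed.

Fact fpr_gmulfF : {morph fpr : x y / x * y^-1}.
Proof.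
move=> x y; rewrite /fpr -[RHS]/(freeprod_mul _ (freeprod_inv _)) freeprod_invE freeprod_mulE.
exact/freeprod_eqP/fpcongr_sym/fpcongr_rM.
Qed.

HB.instance Definition _ := isGroupMorphism.Build G freeprod fpl fpl_gmulfF.
HB.instance Definition _ := isGroupMorphism.Build H freeprod fpr fpr_gmulfF.

Lemma freeprod_ind (P : freeprod -> Prop) :
    P 1 -> (forall x a, P a -> P (fpl x * a)) ->
    (forall x a, P a -> P (fpr x * a)) ->
  forall a, P a.
Proof.
move=> P1 Pl Pr a; rewrite -[a]reprK.
elim: (qrepr a) => [|[x|x] s IHs]; first by rewrite -freeprod_oneE.
  by rewrite (_ : \pi_freeprod _ = fpl x * \pi_freeprod s) ?[RHS]freeprod_mulE //; apply: Pl.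
by rewrite (_ : \pi_freeprod _ = fpr x * \pi_freeprod s) ?[RHS]freeprod_mulE //; apply: Pr.
Qed.

End FreeProduct.

Arguments fpl {G H} x.
Arguments fpr {G H} x.

Section NuTau.
Variable G : groupType.

(* The copy G^* is the second factor: g corresponds to [fpl g], g^* to [fpr g]. *)
Definition nu_relators (r : freeprod G G) : Prop :=
  exists x y z : G,
    r = [~ fpl x, fpr y] ^ (fpl z) * [~ fpl (x ^ z), fpr (y ^ z)]^-1 \/
    r = [~ fpl x, fpr y] ^ (fpr z) * [~ fpl (x ^ z), fpr (y ^ z)]^-1.

Definition nu := quotg (nclosure nu_relators).
HB.instance Definition _ := Group.on nu.

Definition nul (x : G) : nu := qproj (nclosure nu_relators) (fpl x).
Definition nur (x : G) : nu := qproj (nclosure nu_relators) (fpr x).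

Definition nabla_gens (r : nu) : Prop := exists x : G, r = [~ nul x, nur x].

Definition nabla : {pred nu} := gengroup nabla_gens.

Fact nu_ind (P : nu -> Prop) :
    P 1 -> (forall x a, P a -> P (nul x * a)) ->
    (forall x a, P a -> P (nur x * a)) ->
  forall a, P a.
Proof.
move=> P1 Pl Pr a; have [w ->] := qproj_surj a.
elim/freeprod_ind: w => [|x w|x w]; rewrite ?gmulf1 // qprojM; [exact: Pl|exact: Pr].
Qed.

Fact nu_relJ (x y z : G) :
  [~ nul x, nur y] ^ nul z = [~ nul (x ^ z), nur (y ^ z)] /\
  [~ nul x, nur y] ^ nur z = [~ nul (x ^ z), nur (y ^ z)].
Proof.
have relE (a b : freeprod G G) : nu_relators (a * b^-1) ->
    qproj (nclosure nu_relators) a = qproj (nclosure nu_relators) b.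
  move=> Sab; apply/esym/eqP; rewrite qproj_eq; apply/gengroupP/genp_in.
  exists (a * b^-1), b; split=> //; by rewrite conjgE mulgKV.
rewrite /nul /nur -!gmulfR -!gmulfJ.
by split; apply: relE; exists x, y, z; [left|right].
Qed.

Fact nablaJ x y : x \in nabla -> x ^ y \in nabla.
Proof.
apply: gengroupJ => {x y} x y; elim/nu_ind: y x => [|z a IHa|z a IHa] x.
- by rewrite conjg1.
- move=> [g ->]; rewrite conjgM (nu_relJ g g z).1.
  by apply: IHa; exists (g ^ z).
- move=> [g ->]; rewrite conjgM (nu_relJ g g z).2.
  by apply: IHa; exists (g ^ z).
Qed.

HB.instance Definition _ := GroupClosed.on nabla.
HB.instance Definition _ := isConjClosed.Build nu nabla nablaJ.

Definition tau := quotg nabla.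
HB.instance Definition _ := Group.on tau.


End NuTau.

Section BarHomology.
Variable gT : finGroupType.
Local Open Scope ring_scope.

(* The free abelian group on G^n, as integer-valued functions (G is finite).  *)
Definition bar_chain (n : nat) : Type := {ffun n.-tuple gT -> int}.
HB.instance Definition _ n := GRing.Zmodule.on (bar_chain n).

(* d_i [g_1|...|g_(n+1)] is [g_2|...|g_(n+1)] for i = 0,                      *)
(* [g_1|...|g_i g_(i+1)|...|g_(n+1)] for 0 < i < n + 1, and [g_1|...|g_n] for *)
(* i = n + 1; the entries of tuples are numbered from 0 below.                *)
Definition bar_face n (i : nat) (x : n.+1.-tuple gT) : n.-tuple gT :=
  [tuple (if (j.+1 < i)%N then nth 1%g x j
          else if j.+1 == i then (nth 1 x j * nth 1 x j.+1)%g
          else nth 1%g x j.+1) | j < n].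

(* The linear extension of [x] |-> \sum_(i <= n + 1) (-1)^i [d_i x]. *)
Definition bar_d n (c : bar_chain n.+1) : bar_chain n :=
  [ffun y => \sum_(i < n.+2) \sum_(x | bar_face i x == y) (-1) ^+ i * c x].

Fact bar_d_is_zmod_morphism n : zmod_morphism (@bar_d n).
Proof.
move=> c c'; apply/ffunP=> y; rewrite !ffunE -sumrB; apply: eq_bigr => i _.
by rewrite -sumrB; apply: eq_bigr => x _; rewrite !ffunE mulrBr.
Qed.
HB.instance Definition _ n :=
  GRing.isZmodMorphism.Build (bar_chain n.+1) (bar_chain n) (@bar_d n)
    (@bar_d_is_zmod_morphism n).

Definition cycle_pred n : {pred bar_chain n} :=
  match n with
  | 0 => fun=> true
  | m.+1 => fun c : bar_chain m.+1 => bar_d c == 0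
  end.

Fact cycle_zmod_closed n : zmod_closed (@cycle_pred n).
Proof.
case: n => [|n]; split=> //=; first by apply/eqP; rewrite raddf0.
move=> c c' /eqP dc /eqP dc'; apply/eqP.
by rewrite raddfB [LHS]/= dc dc' subr0.
Qed.
HB.instance Definition _ n :=
  GRing.isZmodClosed.Build (bar_chain n) (@cycle_pred n) (cycle_zmod_closed n).

Definition bar_cycle n := {c : bar_chain n | c \in @cycle_pred n}.
HB.instance Definition _ n := SubChoice.on (bar_cycle n).
HB.instance Definition _ n := [SubChoice_isSubZmodule of bar_cycle n by <:].

Definition boundary_pred n : {pred bar_cycle n} :=
  fun z => `[< exists c : bar_chain n.+1, bar_d c = val z >].

Fact boundary_zmod_closed n : zmod_closed (@boundary_pred n).
Proof.
split; first by apply/asboolP; exists 0; rewrite !raddf0.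
move=> z z' /asboolP[c cz] /asboolP[c' cz']; apply/asboolP; exists (c - c').
by rewrite !raddfB /= cz cz'.
Qed.
HB.instance Definition _ n :=
  GRing.isZmodClosed.Build (bar_cycle n) (@boundary_pred n)
    (boundary_zmod_closed n).

Definition homology n := Quotient.quot (@boundary_pred n).
HB.instance Definition _ n := GRing.Zmodule.on (homology n).

End BarHomology.

Section KGroup.
Variables (gT : finGroupType) (n : nat).

Definition KG_set : {set {dffun forall i : 'I_n, gT}} :=
  [set g : {dffun forall i : 'I_n, gT} |
     \prod_(i < n) g i \in [set: gT]^`(1)].

Fact KG_group_set : group_set KG_set.
Proof.
set D := [set: gT]^`(1).
have nD x : x \in 'N(D) by rewrite (subsetP (der_norm 1 [set: gT])) ?inE.
have KE g : (g \in KG_set) = (\prod_(i < n) coset D (g i) == 1).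
  have <- : coset D (\prod_(i < n) g i) = \prod_(i < n) coset D (g i).
    elim/big_rec2: _ => [|i y x _ <-]; first exact: morph1.
    by rewrite morphM.
  rewrite inE; apply/idP/eqP => [/coset_id //|]; exact: coset_idr.
have cD (u v : coset_of D) : u * v = v * u.
  have [x _ ->] := cosetP u; have [y _ ->] := cosetP v.
  by apply: (centsP (der_abelian 0 [set: gT])); rewrite mem_quotient ?inE.
apply/group_setP; split=> [|g h].
  by rewrite KE big1 // => i _; rewrite !ffunE morph1.
rewrite !KE => /eqP g1 /eqP h1.
suff -> : \prod_(i < n) coset D ((g * h) i) =
    \prod_(i < n) coset D (g i) * \prod_(i < n) coset D (h i).
  by rewrite g1 h1 mulg1.
elim/big_rec3: _ => [|i x y z _ ->]; first by rewrite mulg1.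
by rewrite ffunE morphM // -!mulgA; congr (_ * _); rewrite !mulgA (cD _ y).
Qed.

Canonical KG := Group KG_group_set.
End KGroup.

Definition AI_automorphism (gT : finGroupType) (f : {perm gT}) :=
  f \in Aut [set: gT] /\
  forall x : gT,
    coset [set: gT]^`(1) (f x) = (coset [set: gT]^`(1) x)^-1.

Definition central_extension (A E Q : groupType)
    (i : {multiplicative A -> E}) (p : {multiplicative E -> Q}) :=
  [/\ injective i,
      forall q : Q, exists e : E, p e = q,
      forall e : E, p e = 1 <-> exists a : A, i a = e
    & forall (a : A) (e : E), commute (i a) e].

(* Main.v *)
Require Import Defs.
From HB Require Import structures.
From mathcomp Require Import all_boot all_order all_fingroup all_algebra all_solvable.
From mathcomp Require Import boolp ring.

(** Write G for the finite group, M for the subgroup of tau(G) generated by the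
    commutators of elements of G with elements of the copy of G, x /\ y for
    [[x, y^*]], and H for the second integral homology group. There is a
    homomorphism from tau(G) to the cube of G that sends x to (x, x, 1) and y^* to
    (1, y, y). Its image consists of the triples (a, b, c) such that b and a c
    agree modulo G', so applying an AI-automorphism to b turns it into a surjection
    onto K(G,3). Its kernel is the kernel of M -> G', x /\ y |-> [[x, y]], and the
    point is to identify this kernel with H.

    Let B be the cokernel of the third bar boundary. The classes of the [[g|h]] form
    the universal 2-cocycle of G; let E be the central extension of G by B that it
    defines. As the degree 1 chains form a free abelian group, an element (a, g) of
    E lies in E' as soon as d a + [[g]] = 0 ([univ_ext_der]). Conversely the chain
    d a + [[g]] depends multiplicatively on (a, g) and so vanishes on E'. Hence the
    intersection of B and E' is the kernel of d on B, which is H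
    ([homology2_embed]). Twisting the universal cocycle over the three coordinates
    gives a central extension by B of the cube of G, the model, which contains E
    over the middle coordinate. The homomorphism above lifts to the model
    ([tau_to_model]), with x /\ y sent to the commutator of lifts of x and y in E,
    so that M is mapped onto E' ([tau_model_der]). The statement thus reduces to the
    injectivity of M -> E', which is [tau_model_inj].

    For injectivity it suffices, E being universal ([univ_ext_lift]), to embed M in
    a central extension L of G in which the commutator of lifts of x and y is
    x /\ y. Starting from M itself, which lies over G', the elements x of G are
    adjoined one by one: the cyclic group generated by x acts on a group L over G
    by l |-> l (pi l /\ x), and as x^i /\ x^j = 1, the commutators in the semidirect
    product are again given by the exterior pairing ([wedge_stepP]). *)

Set Implicit Arguments.
Unset Strict Implicit.
Unset Printing Implicit Defensive.

Import GRing.Theory.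
Import GroupScope.

Local Notation qrepr := generic_quotient.repr.

(** Homomorphisms of groups: the bundled maps that preserve products and [1]. *)
Local Notation "{ 'ghom' G -> H }" := (UMagmaMorphism.type G H)
  (at level 0, G at level 98, H at level 99, format "{ 'ghom'  G  ->  H }").

(** * Universal properties of quotients, free products and tau *)
Section GHom.
Variables (G H : groupType) (f : G -> H) (fM : {morph f : x y / x * y}).

Fact ghom_of_subproof : {morph f : x y / x * y^-1}.
Proof.
move=> x y; rewrite fM; congr (_ * _); apply/esym/mulg1_eq.
by rewrite -fM mulgV; apply: (mulgI (f 1)); rewrite -fM !mulg1.
Qed.

(** Between groups, preserving products is enough to be a homomorphism. *)
Definition ghom_of : {ghom G -> H} :=
  HB.pack_for {ghom G -> H} f (isGroupMorphism.Build G H f ghom_of_subproof).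
End GHom.

Lemma genp_ghom1 (G H : groupType) (S : G -> Prop) (f : {ghom G -> H}) :
  (forall x, S x -> f x = 1) -> forall x, x \in gengroup S -> f x = 1.
Proof.
move=> fS x /gengroupP; elim=> {x} [x /fS //||x y _ IHx _ IHy|x _ IHx].
- exact: gmulf1.
- by rewrite gmulfM IHx IHy mulg1.
- by rewrite gmulfV IHx invg1.
Qed.

Lemma nclosure_ghom1 (G H : groupType) (S : G -> Prop) (f : {ghom G -> H}) :
  (forall x, S x -> f x = 1) -> forall x, x \in nclosure S -> f x = 1.
Proof.
move=> fS; apply: genp_ghom1 => _ [x [z [/fS fx ->]]].
by rewrite gmulfJ fx conj1g.
Qed.

Lemma quotg_lift (G H : groupType) (N : normalClosed G) (f : {ghom G -> H}) :
  (forall x, x \in N -> f x = 1) ->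
  exists h : {ghom quotg N -> H}, forall x, h (qproj N x) = f x.
Proof.
move=> fN; pose h (a : quotg N) := f (qrepr a).
have hE x : h (qproj N x) = f x.
  have : (qrepr (qproj N x))^-1 * x \in N by rewrite -quotg_eqE /qproj reprK.
  by move/fN; rewrite gmulfM gmulfV => /mulg1_eq; rewrite invgK.
have hM : {morph h : a b / a * b}.
  move=> a b; have [x ->] := qproj_surj a; have [y ->] := qproj_surj b.
  by rewrite -qprojM !hE gmulfM.
by exists (ghom_of hM).
Qed.

Lemma freeprod_lift (G H K : groupType) (f : {ghom G -> K}) (g : {ghom H -> K}) :
  exists h : {ghom freeprod G H -> K},
    (forall x, h (fpl x) = f x) /\ (forall x, h (fpr x) = g x).
Proof.
pose ev (w : fpword G H) : K :=
  foldr (fun l a => match l with inl x => f x | inr x => g x end * a) 1 w.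
have evM v w : ev (v ++ w) = ev v * ev w.
  by elim: v => [|l v IHv] /=; rewrite ?mul1g // IHv mulgA.
have evP v w : fpcongr v w -> ev v = ev w.
  elim=> {v w} // [s t u _ -> _ -> //|s s' t t' _ IHs _ IHt||| x y|x y] /=.
  - by rewrite !evM IHs IHt.
  - by rewrite gmulf1 mulg1.
  - by rewrite gmulf1 mulg1.
  - by rewrite gmulfM !mulg1.
  - by rewrite gmulfM !mulg1.
pose h (a : freeprod G H) := ev (qrepr a).
have hE w : h (\pi_(freeprod G H) w)%qT = ev w by apply/evP/fpcongr_repr.
have hM : {morph h : a b / a * b}.
  move=> a b; rewrite -[a]reprK -[b]reprK -[_ * _]/(freeprod_mul _ _).
  by rewrite freeprod_mulE !hE evM.
by exists (ghom_of hM); split=> x; rewrite /= hE /= mulg1.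
Qed.

Section Tau.
Variable G : groupType.

(** The images in [tau G] of [g] and of [g^*]. *)
Definition tl (x : G) : tau G := qproj (@nabla G) (nul x).
Definition tr (x : G) : tau G := qproj (@nabla G) (nur x).

Lemma tlM : {morph tl : x y / x * y}.
Proof. by move=> x y; rewrite /tl /nul !gmulfM. Qed.

Lemma trM : {morph tr : x y / x * y}.
Proof. by move=> x y; rewrite /tr /nur !gmulfM. Qed.

HB.instance Definition _ := isGroupMorphism.Build G (tau G) tl (ghom_of_subproof tlM).
HB.instance Definition _ := isGroupMorphism.Build G (tau G) tr (ghom_of_subproof trM).

Lemma tau_ind (P : tau G -> Prop) :
    P 1 -> (forall x a, P a -> P (tl x * a)) -> (forall x a, P a -> P (tr x * a)) ->
  forall a, P a.
Proof.
move=> P1 Pl Pr a; have [t ->] := qproj_surj a.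
by elim/nu_ind: t => [|x t|x t]; rewrite ?gmulf1 // gmulfM; [apply: Pl | apply: Pr].
Qed.

Lemma tau_relJ (x y z : G) :
  [~ tl x, tr y] ^ tl z = [~ tl (x ^ z), tr (y ^ z)] /\
  [~ tl x, tr y] ^ tr z = [~ tl (x ^ z), tr (y ^ z)].
Proof.
have [Hl Hr] := nu_relJ x y z.
by split; rewrite /tl /tr -!(gmulfR (qproj (@nabla G))) -(gmulfJ (qproj (@nabla G)))
  ?Hl ?Hr.
Qed.

Lemma tau_relD (x : G) : [~ tl x, tr x] = 1.
Proof.
have <- : qproj (@nabla G) 1 = 1 by rewrite gmulf1.
apply/esym/eqP; rewrite /tl /tr -gmulfR qproj_eq invg1 mul1g.
by apply/gengroupP/genp_in; exists x.
Qed.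

(** The universal property of [tau G]: two homomorphisms out of [G] satisfying
    the defining relations induce a homomorphism out of [tau G]. *)
Lemma tau_lift (H : groupType) (f g : {ghom G -> H}) :
    (forall x y z, [~ f x, g y] ^ f z = [~ f (x ^ z), g (y ^ z)]) ->
    (forall x y z, [~ f x, g y] ^ g z = [~ f (x ^ z), g (y ^ z)]) ->
    (forall x, [~ f x, g x] = 1) ->
  exists h : {ghom tau G -> H},
    (forall x, h (tl x) = f x) /\ (forall x, h (tr x) = g x).
Proof.
move=> relf relg relD; have [h0 [h0l h0r]] := freeprod_lift f g.
have [|h1 h1E] := @quotg_lift _ _ (nclosure (@nu_relators G)) h0.
  apply: nclosure_ghom1 => _ [x [y [z [|] ->]]].
    by rewrite gmulfM gmulfV gmulfJ !gmulfR !h0l !h0r relf mulgV.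
  by rewrite gmulfM gmulfV gmulfJ !gmulfR !h0l !h0r relg mulgV.
have [|h hE] := @quotg_lift _ _ (@nabla G) h1.
  apply: genp_ghom1 => _ [x ->].
  by rewrite gmulfR /nul /nur !h1E h0l h0r.
by exists h; split=> x; rewrite /tl /tr hE /nul /nur h1E.
Qed.

End Tau.

(** * The exterior square inside tau *)

Lemma commMg (G : groupType) (x y z : G) : [~ x * y, z] = [~ x, z] ^ y * [~ y, z].
Proof. by rewrite /commg /conjg !gnorm. Qed.

Lemma commgM (G : groupType) (x y z : G) : [~ x, y * z] = [~ x, z] * [~ x, y] ^ z.
Proof. by rewrite /commg /conjg !gnorm. Qed.

Section TauWedge.
Variable G : groupType.

(** The element [[x, y^*]] of [tau G]; it plays the part of [x /\ y] in the
    exterior square of [G]. *)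
Definition twedge (x y : G) : tau G := [~ tl x, tr y].

(** The subgroup [[G, G^*]] of [tau G], a copy of the exterior square of [G]. *)
Definition ext_square : {pred tau G} :=
  gengroup (fun t : tau G => exists x y, t = twedge x y).

HB.instance Definition _ := GroupClosed.on ext_square.

Lemma twedgeJ x y t z : t = tl z \/ t = tr z ->
  twedge x y ^ t = twedge (x ^ z) (y ^ z).
Proof. by case: (tau_relJ x y z) => Hl Hr [] ->. Qed.

Lemma twedge_in x y : twedge x y \in ext_square.
Proof. by apply/gengroupP/genp_in; exists x, y. Qed.

Lemma ext_squareJ m t : m \in ext_square -> m ^ t \in ext_square.
Proof.
apply: gengroupJ => {m} m {}t; elim/tau_ind: t m => [m|z t IHt m|z t IHt m].
- by rewrite conjg1.
- move=> [x [y ->]]; rewrite conjgM (twedgeJ _ _ (z := z)); last by left.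
  by apply: IHt; exists (x ^ z), (y ^ z).
- move=> [x [y ->]]; rewrite conjgM (twedgeJ _ _ (z := z)); last by right.
  by apply: IHt; exists (x ^ z), (y ^ z).
Qed.

(** [G] and [G^*] act in the same way on [[G, G^*]]. *)
Lemma ext_squareJr m z : m \in ext_square -> m ^ tr z = m ^ tl z.
Proof.
move=> /gengroupP; elim=> {m} [_ [x [y ->]]||m n _ IHm _ IHn|m _ IHm].
- by rewrite !(twedgeJ _ _ (z := z)); [|left|right].
- by rewrite !conj1g.
- by rewrite !conjMg IHm IHn.
- by rewrite !conjVg IHm.
Qed.

(** The folding homomorphism sends both [g] and [g^*] to [g]. *)
Lemma tau_fold : exists pm : {ghom tau G -> G},
  (forall x, pm (tl x) = x) /\ (forall x, pm (tr x) = x).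
Proof.
pose i : {ghom G -> G} := idfun.
by apply: (@tau_lift _ _ i i) => [x y z|x y z|x]; rewrite ?conjRg ?commgg.
Qed.

Variable pm : {ghom tau G -> G}.
Hypotheses (pml : forall x, pm (tl x) = x) (pmr : forall x, pm (tr x) = x).

Lemma pm_twedge x y : pm (twedge x y) = [~ x, y].
Proof. by rewrite /twedge gmulfR pml pmr. Qed.

(** By [ext_squareJr], conjugation on [[G, G^*]] only depends on the image under
    folding. *)
Lemma ext_squareJE m t : m \in ext_square -> m ^ t = m ^ tl (pm t).
Proof.
move=> Mm; elim/tau_ind: t m Mm => [|z t IHt|z t IHt] m Mm.
- by rewrite !gmulf1.
- by rewrite conjgM IHt ?ext_squareJ // gmulfM pml gmulfM conjgM.
- by rewrite conjgM IHt ?ext_squareJ // gmulfM pmr gmulfM conjgM ext_squareJr.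
Qed.

Lemma twedgeMl x y z : twedge (x * y) z = twedge x z ^ tl y * twedge y z.
Proof. by rewrite /twedge gmulfM commMg. Qed.

Lemma twedgeMr x y z : twedge x (y * z) = twedge x z * twedge x y ^ tr z.
Proof. by rewrite /twedge gmulfM commgM. Qed.

Lemma twedge1l x : twedge 1 x = 1.
Proof. by rewrite /twedge gmulf1 comm1g. Qed.

Lemma twedgeVl x y : twedge x^-1 y = (twedge x y)^-1 ^ tl x^-1.
Proof.
apply: (mulgI (twedge x y ^ tl x^-1)).
by rewrite -twedgeMl mulgV twedge1l -conjMg mulgV conj1g.
Qed.

(** The relation [[[x, y], z^*] = [[x, y^*], z^*]], which makes folding restricted
    to [[G, G^*]] compatible with the exterior pairing. *)
Lemma twedge_triple x y z : twedge [~ x, y] z = (twedge x y)^-1 * twedge x y ^ tl z.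
Proof.
apply: (mulgI (twedge x y)); rewrite mulVKg.
have -> : [~ x, y] = x^-1 * x ^ y by [].
rewrite twedgeMl twedgeVl -conjgM -gmulfM -[x^-1 * _]/[~ x, y].
rewrite -(pm_twedge x y) -ext_squareJE; last by rewrite gpredV twedge_in.
(* The two factors in [y] recombine since [z ^ y^-1 * y = y * z]. *)
have -> : twedge (x ^ y) z = twedge x (z ^ y^-1) ^ tr y.
  by rewrite (twedgeJ _ _ (z := y)) ?conjgKV //; right.
rewrite mulgA conjgE mulVKg -mulgA -twedgeMr.
have -> : z ^ y^-1 * y = y * z by rewrite /conjg !gnorm.
by rewrite twedgeMr mulKg ext_squareJr ?twedge_in.
Qed.

Lemma twedge_ext_square m z : m \in ext_square ->
  twedge (pm m) z = m^-1 * m ^ tl z.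
Proof.
move=> /gengroupP; elim=> {m} [_ [x [y ->]]||m n Mm IHm Mn IHn|m Mm IHm].
- by rewrite pm_twedge twedge_triple.
- by rewrite gmulf1 twedge1l conj1g mulVg.
- rewrite gmulfM twedgeMl -ext_squareJE ?twedge_in // IHm IHn.
  by rewrite conjMg /conjg !gnorm.
- rewrite gmulfV twedgeVl -gmulfV -ext_squareJE ?gpredV ?twedge_in // IHm.
  by rewrite conjVg /conjg !gnorm.
Qed.

Lemma twedgeXX x i j : twedge (x ^+ i) (x ^+ j) = 1.
Proof.
have cx : commute (tl x) (tr x) by apply/commgP/eqP/tau_relD.
apply/eqP/commgP; rewrite !gmulfXn.
have /commute_sym cxi : commute (tr x) (tl x ^+ i) by apply: commuteX; apply: commute_sym.
exact: commuteX.
Qed.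

Lemma twedgeC x y : twedge x y * twedge y x = 1.
Proof.
have D z : twedge z z = 1 by apply: tau_relD.
(* Expand [twedge (x * y) (x * y) = 1]. *)
apply: (conjg_inj (tl y)); rewrite conj1g -(D (x * y)) twedgeMl !twedgeMr !D.
by rewrite conj1g mulg1 mul1g conjMg (ext_squareJr _ (twedge_in _ _)).
Qed.

(** Every element of [tau G] is a product of elements of [[G, G^*]], [G], [G^*]. *)
Lemma tau_decomp t : exists m x y,
  m \in ext_square /\ t = m * (tl x * tr y).
Proof.
elim/tau_ind: t => [|z _ [m [x [y [Mm ->]]]]|z _ [m [x [y [Mm ->]]]]].
- by exists 1, 1, 1; rewrite gpred1 !gmulf1 !mulg1.
- exists (m ^ tl z^-1), (z * x), y; rewrite ext_squareJ //; split=> //.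
  by rewrite tlM gmulfV /conjg !gnorm.
- exists (m ^ tr z^-1 * (twedge x^-1 z^-1)^-1), x, (z * y); split.
    by rewrite gpredM ?ext_squareJ // gpredV twedge_in.
  by rewrite /twedge trM !gmulfV /commg /conjg !gnorm.
Qed.

End TauWedge.

(** * Groups with an exterior pairing *)

Section SemidirectProduct.
Variables C L : groupType.

(** [act] is a right action of [C] on [L] by automorphisms. *)
Definition right_autact (act : L -> C -> L) : Prop :=
  [/\ forall c, {morph act^~ c : l k / l * k},
      forall l, act l 1 = l
    & forall l c d, act l (c * d) = act (act l c) d].

Variables (act : L -> C -> L) (actP : right_autact act).

(** The external semidirect product of [C] and [L]; the pair [(c, l)] stands for
    [c * l]. The type depends on the proof that [act] is an action, so that the
    group structure can be found from the type alone. *)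
Definition sdpair : Type := let _ := actP in (C * L)%type.
HB.instance Definition _ := Choice.on sdpair.

Definition sdpair_mul (p q : sdpair) : sdpair := (p.1 * q.1, act p.2 q.1 * q.2).
Definition sdpair_one : sdpair := (1, 1).
Definition sdpair_inv (p : sdpair) : sdpair := (p.1^-1, (act p.2 p.1^-1)^-1).

Fact sdpair_act1 c : act 1 c = 1.
Proof. by have [aM _ _] := actP; apply: (mulgI (act 1 c)); rewrite -aM !mulg1. Qed.

Fact sdpair_mulA : associative sdpair_mul.
Proof.
have [aM _ aA] := actP.
by move=> p q r; rewrite /sdpair_mul /= !mulgA aM aA.
Qed.

Fact sdpair_mul1 : left_id sdpair_one sdpair_mul.
Proof. by case=> c l; rewrite /sdpair_mul /= sdpair_act1 !mul1g. Qed.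

Fact sdpair_mul1r : right_id sdpair_one sdpair_mul.
Proof. by have [_ a1 _] := actP; case=> c l; rewrite /sdpair_mul /= a1 !mulg1. Qed.

Fact sdpair_mulV : left_inverse sdpair_one sdpair_inv sdpair_mul.
Proof.
have [aM a1 aA] := actP; case=> c l; rewrite /sdpair_mul /= mulVg.
congr (_, _); rewrite -{2}[l]a1 -(mulVg c) aA -aM mulVg; exact: sdpair_act1.
Qed.

Fact sdpair_mulVr : right_inverse sdpair_one sdpair_inv sdpair_mul.
Proof. by case=> c l; rewrite /sdpair_mul /= !mulgV. Qed.

HB.instance Definition _ := isGroup.Build sdpair
  sdpair_mulA sdpair_mul1 sdpair_mul1r sdpair_mulV sdpair_mulVr.

Lemma sdpairME (p q : sdpair) : p * q = (p.1 * q.1, act p.2 q.1 * q.2) :> sdpair.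
Proof. by []. Qed.

End SemidirectProduct.

(** A group [L] over [G] with an exterior pairing [w] of [G] in [L] such that the
    commutator of two elements of [L] is the pairing of their images in [G]. The
    clauses on products are the usual rules for [x /\ y], written without an
    action of [G] on [L]: the conjugate of [w x z] by [y] is
    [w x z * w [~ x, z] y]. In particular the kernel of [pi] is central. *)
Record wedge_group (G L : groupType) (pi : {ghom L -> G}) (w : G -> G -> L) : Prop :=
  WedgeGroup {
    wedgeP : forall x y, pi (w x y) = [~ x, y];
    wedgeMl : forall x y z, w (x * y) z = w x z * w [~ x, z] y * w y z;
    wedgeMr : forall x y z, w x (y * z) = w x z * (w x y * w [~ x, y] z);
    wedgeXX : forall x i j, w (x ^+ i) (x ^+ j) = 1;
    wedgeC : forall x y, w x y * w y x = 1;
    wedgeR : forall l k, [~ l, k] = w (pi l) (pi k)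
  }.

Section WedgeStep.
Variables (G L : groupType) (pi : {ghom L -> G}) (w : G -> G -> L).
Hypothesis wP : wedge_group pi w.

Lemma wedge1r x : w x 1 = 1.
Proof.
have w11 : w 1 1 = 1 := wedgeXX wP 1 0 0.
apply: (mulgI (w x 1)); rewrite mulg1 -[in RHS](mulg1 1) (wedgeMr wP).
by rewrite commg1 w11 mulg1.
Qed.

Lemma wedgeJ x y l : w x y ^ l = w x y * w [~ x, y] (pi l).
Proof. by rewrite -(wedgeP wP) -(wedgeR wP) /commg mulVKg. Qed.

Lemma wedgeMl_pi x l z : w (x * pi l) z = w x z ^ l * w (pi l) z.
Proof. by rewrite wedgeJ (wedgeMl wP). Qed.

Lemma wedgeMr_pi x y l : w x (y * pi l) = w x (pi l) * w x y ^ l.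
Proof. by rewrite wedgeJ (wedgeMr wP). Qed.

(** Given a commutative group [C] over [G] on which the pairing vanishes, [C]
    acts on [L] by [l |-> l * w (pi l) (c i)], and the semidirect product is again
    a [wedge_group]: its elements of [C] lift the image of [c]. *)
Variables (C : groupType) (c : {ghom C -> G}).
Hypotheses (cC : forall i j : C, i * j = j * i).
Hypotheses (wc : forall i j, w (c i) (c j) = 1).

Definition wedge_act (l : L) (i : C) : L := l * w (pi l) (c i).

Lemma wedge_actP : right_autact wedge_act.
Proof.
rewrite /wedge_act; split=> [i l k|l|l i j].
- by rewrite gmulfM wedgeMl_pi /conjg !gnorm.
- by rewrite gmulf1 wedge1r mulg1.
- rewrite !gmulfM (wedgeP wP) (wedgeMr wP) (wedgeMl wP (pi l)) -!mulgA; congr (_ * _).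
  rewrite !mulgA; congr (_ * _).
  by rewrite [LHS]commgC (wedgeR wP) !(wedgeP wP).
Qed.

Let L' := sdpair wedge_actP.

Fact wedge_pi_subproof : {morph (fun p : L' => c p.1 * pi p.2) : p q / p * q}.
Proof.
case=> i l [j k] /=; rewrite /wedge_act !gmulfM (wedgeP wP) /commg /conjg.
by rewrite !gnorm.
Qed.

Definition wedge_pi : {ghom L' -> G} := ghom_of wedge_pi_subproof.

Definition wedge_w (x y : G) : L' := (1, w x y).

Fact wedge_in_subproof : {morph (fun l : L => (1, l) : L') : l k / l * k}.
Proof.
by move=> l k; rewrite sdpairME /= mulg1 /wedge_act gmulf1 wedge1r mulg1.
Qed.

Definition wedge_in : {ghom L -> L'} := ghom_of wedge_in_subproof.

Lemma wedge_stepP : wedge_group wedge_pi wedge_w.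
Proof.
have inE x y : wedge_w x y = wedge_in (w x y) by [].
split=> [x y|x y z|x y z|x i j|x y|p q].
- by rewrite /= gmulf1 mul1g (wedgeP wP).
- by rewrite !inE (wedgeMl wP) !gmulfM.
- by rewrite !inE (wedgeMr wP) !gmulfM.
- by rewrite !inE (wedgeXX wP) gmulf1.
- by rewrite !inE -gmulfM (wedgeC wP) gmulf1.
case: p q => i l [j k]; apply: (mulgI (((j, k) : L') * (i, l))); rewrite -commgC.
rewrite !sdpairME /= mulg1 cC; congr (_, _).
rewrite /wedge_act gmulf1 wedge1r mulg1 wedgeMl_pi !wedgeMr_pi wc conj1g mulg1.
rewrite -(wedgeR wP l k); have /mulg1_eq <- := wedgeC wP (pi k) (c i).
by rewrite /commg /conjg !gnorm.
Qed.

End WedgeStep.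

Lemma wedge_adjoin (gT : finGroupType) (L : groupType) (pi : {ghom L -> gT})
    (w : gT -> gT -> L) (x : gT) :
  wedge_group pi w ->
  exists (L' : groupType) (pi' : {ghom L' -> gT}) (j : {ghom L -> L'}),
    [/\ wedge_group pi' (fun y z => j (w y z)), injective j,
        forall l, pi' (j l) = pi l & exists l, pi' l = x].
Proof.
move=> wP.
have cM : {morph (@sgval _ <[x]>%G) : u v / u * v} by [].
pose c : {ghom (subg_of <[x]>%G) -> gT} := ghom_of cM.
have cC (u v : subg_of <[x]>%G) : u * v = v * u.
  have /cycleP[i ui] := subgP u; have /cycleP[k vk] := subgP v.
  apply: subg_inj; change (sgval u * sgval v = sgval v * sgval u).
  by rewrite ui vk -!expgnDr addnC.
have wc u v : w (c u) (c v) = 1.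
  have /cycleP[i cu] := subgP u; have /cycleP[k cv] := subgP v.
  by rewrite /= cu cv (wedgeXX wP).
exists (sdpair (wedge_actP wP c)), (wedge_pi wP c), (wedge_in wP c); split.
- exact: wedge_stepP cC wc.
- by move=> l k [].
- by move=> l; apply: mul1g.
- by exists (subg <[x]>%G x, 1); rewrite -[LHS]/(sgval _ * pi 1) gmulf1 mulg1
    subgK ?cycle_id.
Qed.

(** Adjoining the elements of a finite group one after the other makes the
    projection surjective. *)
Lemma wedge_surj (gT : finGroupType) (L : groupType) (pi : {ghom L -> gT})
    (w : gT -> gT -> L) :
  wedge_group pi w ->
  exists (L' : groupType) (pi' : {ghom L' -> gT}) (j : {ghom L -> L'}),
    [/\ wedge_group pi' (fun y z => j (w y z)), injective j
      & forall x, exists l, pi' l = x].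
Proof.
move=> wP; suff [L' [pi' [j [wP' jI _ pi_s]]]] :
    exists (L' : groupType) (pi' : {ghom L' -> gT}) (j : {ghom L -> L'}),
    [/\ wedge_group pi' (fun y z => j (w y z)), injective j,
        forall l, pi' (j l) = pi l & forall x, x \in enum gT -> exists l, pi' l = x].
  by exists L', pi', j; split=> // x; apply: pi_s; rewrite mem_enum.
elim: (enum gT) => [|x s [L1 [pi1 [j1 [wP1 j1I pi1E pi1s]]]]].
  by exists L, pi, idfun; split.
have [L2 [pi2 [j2 [wP2 j2I pi2E pi2x]]]] := wedge_adjoin x wP1.
exists L2, pi2, (j2 \o j1); split=> // [|l|y].
- exact: inj_comp.
- by rewrite /= pi2E.
- rewrite inE => /predU1P[-> //|/pi1s[l <-]]; by exists (j2 l).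
Qed.

(** The subgroup [[G, G^*]] of [tau G] as a group of its own. *)
Definition extsq (G : groupType) : Type := {t : tau G | t \in @ext_square G}.

Section ExtSquare.
Variable G : groupType.
HB.instance Definition _ := SubChoice.on (extsq G).

Fact ext_square_group_closed : group_closed (@ext_square G).
Proof. by split=> [|s t Ms Mt]; [apply: gpred1 | apply: gpredF]. Qed.
HB.instance Definition _ := SubChoice_isSubGroup.Build (tau G) (@ext_square G) (extsq G)
  ext_square_group_closed.

Definition sqwedge (x y : G) : extsq G := Sub (twedge x y) (twedge_in x y).

Lemma sqwedge_group : exists pi : {ghom extsq G -> G}, wedge_group pi sqwedge.
Proof.
have [pm [pml pmr]] := tau_fold G.
exists (pm \o (\val : extsq G -> tau G)).
have tri := twedge_triple pml pmr.
have JE := ext_squareJE pml pmr.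
split=> [x y|x y z|x y z|x i j|x y|[l Ml] [k Mk]]; last 5 first.
- by apply: val_inj; rewrite !valM /= twedgeMl tri /commg /conjg !gnorm.
- apply: val_inj; rewrite !valM /= twedgeMr ext_squareJr ?twedge_in // tri.
  by rewrite mulVKg.
- by apply: val_inj; rewrite /= twedgeXX.
- by apply: val_inj; rewrite valM /= twedgeC.
- apply: val_inj; rewrite gmulfR /= (twedge_ext_square pml pmr) //.
  by rewrite -JE.
exact: pm_twedge.
Qed.

End ExtSquare.

(** The exterior square of [gT] embeds in a central extension [L] of [gT], in such
    a way that the exterior pairing computes the commutators of [L]. *)
Lemma extsq_embed (gT : finGroupType) :
  exists (L : groupType) (pi : {ghom L -> gT}) (j : {ghom extsq gT -> L}),
    [/\ forall x, exists l, pi l = x, injective j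
      & forall l k, [~ l, k] = j (sqwedge (pi l) (pi k))].
Proof.
have [pi0 /wedge_surj[L [pi [j [wP jI pi_s]]]]] := sqwedge_group gT.
by exists L, pi, j; split=> // l k; rewrite (wedgeR wP).
Qed.

(** * Low-degree bar chains *)

Section AddHom.
Variables (U V : zmodType) (f : U -> V) (fD : {morph f : x y / (x + y)%R >-> (x + y)%R}).
Local Open Scope ring_scope.

Fact addhom_of_subproof : zmod_morphism f.
Proof.
move=> x y; apply: (addIr (f y)).
by rewrite -fD !subrK.
Qed.

Definition addhom_of : {additive U -> V} :=
  HB.pack_for {additive U -> V} f (GRing.isZmodMorphism.Build U V f addhom_of_subproof).
End AddHom.

(** Additive maps killing a subgroup factor through the quotient. *)
Lemma zmod_quot_lift (U V : zmodType) (I : zmodClosed U) (f : {additive U -> V}) :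
  (forall x, x \in I -> f x = 0%R) ->
  exists h : {additive Quotient.quot I -> V},
    forall x, h (\pi_(Quotient.quot I) x)%qT = f x.
Proof.
move=> fI; pose h (a : Quotient.quot I) := f (qrepr a).
have hE x : h (\pi_(Quotient.quot I) x)%qT = f x.
  apply/eqP; rewrite -GRing.subr_eq0 -GRing.raddfB; apply/eqP/fI.
  by rewrite Quotient.idealrBE reprK.
have hD : {morph h : a b / (a + b)%R >-> (a + b)%R}.
  by move=> a b; rewrite -[a]reprK -[b]reprK -GRing.raddfD !hE GRing.raddfD.
by exists (addhom_of hD).
Qed.

Section BarBasis.
Variable gT : finGroupType.
Local Open Scope ring_scope.

(** The basis element [[g_1|...|g_n]] of the bar chains. *)
Definition bar n (x : n.-tuple gT) : bar_chain gT n := [ffun y => (x == y)%:Z].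

Lemma bar_chainE n (c : bar_chain gT n) : c = \sum_x bar x *~ c x.
Proof.
apply/ffunP=> y; rewrite sum_ffunE (bigD1 y) //= big1 => [|x /negPf xy].
  by rewrite addr0 ffunMzE ffunE eqxx mulrzz mul1r.
by rewrite ffunMzE ffunE xy mul0rz.
Qed.

Lemma bar_ext (V : zmodType) n (f h : {additive bar_chain gT n -> V}) :
  (forall x, f (bar x) = h (bar x)) -> f =1 h.
Proof.
move=> fh c; rewrite [c]bar_chainE !raddf_sum; apply: eq_bigr => x _.
by rewrite !raddfMz fh.
Qed.

(** The group of bar chains is free on the basis elements. *)
Lemma bar_lift (V : zmodType) n (F : n.-tuple gT -> V) :
  exists f : {additive bar_chain gT n -> V}, forall x, f (bar x) = F x.
Proof.
pose f (c : bar_chain gT n) := \sum_x F x *~ c x.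
have fD : {morph f : c d / c + d}.
  move=> c d; rewrite /f -big_split; apply: eq_bigr => x _.
  by rewrite ffunE mulrzDr.
exists (addhom_of fD) => x; rewrite /= /f (bigD1 x) //= big1 => [|y /negPf xy].
  by rewrite addr0 ffunE eqxx mulr1z.
by rewrite ffunE eq_sym xy mulr0z.
Qed.

Lemma bar_d_bar n (x : n.+1.-tuple gT) :
  bar_d (bar x) = \sum_(i < n.+2) bar (bar_face i x) *~ (-1) ^+ i.
Proof.
apply/ffunP=> y; rewrite ffunE sum_ffunE; apply: eq_bigr => i _.
rewrite ffunMzE ffunE mulrzz big_mkcond (bigD1 x) //= big1 => [|z /negPf xz].
  by rewrite addr0 ffunE eqxx mulr1; case: eqP; rewrite ?mul1r ?mul0r.
by rewrite ffunE [x == z]eq_sym xz mulr0 if_same.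
Qed.

Definition bar1 (g : gT) : bar_chain gT 1 := bar [tuple g].
Definition bar2 (g h : gT) : bar_chain gT 2 := bar [tuple g; h].

Lemma bar_d2 g h : bar_d (bar2 g h) = bar1 h - bar1 (g * h)%g + bar1 g.
Proof.
have F i y : (forall j, tnth (bar_face i [tuple g; h]) j = tnth y j) ->
    bar_face i [tuple g; h] = y by exact: eq_from_tnth.
rewrite bar_d_bar !big_ord_recl big_ord0 /= -[bump 0 0]/1%N -[bump 0 1]/2%N.
rewrite (F 0%N [tuple h]); last by case=> [[]] // ?; rewrite tnth_mktuple.
rewrite (F 1%N [tuple g * h]%g); last by case=> [[]] // ?; rewrite tnth_mktuple.
rewrite (F 2%N [tuple g]); last by case=> [[]] // ?; rewrite tnth_mktuple.
by rewrite addr0 addrA.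
Qed.

Definition bar3 (g h k : gT) : bar_chain gT 3 := bar [tuple g; h; k].

Lemma bar_d3 g h k : bar_d (bar3 g h k) =
  bar2 h k - bar2 (g * h)%g k + bar2 g (h * k)%g - bar2 g h.
Proof.
have F i y : (forall j, tnth (bar_face i [tuple g; h; k]) j = tnth y j) ->
    bar_face i [tuple g; h; k] = y by exact: eq_from_tnth.
rewrite bar_d_bar !big_ord_recl big_ord0 /=.
rewrite -[bump 0 0]/1%N -[bump 0 1]/2%N -[bump 0 2]/3%N.
rewrite (F 0%N [tuple h; k]); last by case=> [[|[]]] // ?; rewrite tnth_mktuple.
rewrite (F 1%N [tuple g * h; k]%g); last by case=> [[|[]]] // ?; rewrite tnth_mktuple.
rewrite (F 2%N [tuple g; h * k]%g); last by case=> [[|[]]] // ?; rewrite tnth_mktuple.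
rewrite (F 3%N [tuple g; h]); last by case=> [[|[]]] // ?; rewrite tnth_mktuple.
by rewrite addr0 !addrA.
Qed.

Lemma bar3_ext (V : zmodType) (f h : {additive bar_chain gT 3 -> V}) :
  (forall g g' g'', f (bar3 g g' g'') = h (bar3 g g' g'')) -> f =1 h.
Proof.
move=> fh; apply: bar_ext => x; case/tupleP: x => a x; case/tupleP: x => b x.
case/tupleP: x => c x; rewrite (tuple0 x).
by rewrite (_ : [tuple of _] = [tuple a; b; c]) ?fh //; apply/val_inj.
Qed.

Lemma bar_dd (c : bar_chain gT 3) : bar_d (bar_d c) = 0.
Proof.
pose dd : {additive bar_chain gT 3 -> bar_chain gT 1} := @bar_d gT 1 \o @bar_d gT 2.
apply: (bar3_ext (f := dd) (h := \0%R)) => g h k /=.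
rewrite bar_d3 !raddfB !raddfD !raddfN /= !bar_d2 mulgA.
by apply/ffunP=> y; rewrite !ffunE; ring.
Qed.

End BarBasis.

Section BarQuotient.
Variable gT : finGroupType.
Local Open Scope ring_scope.
Local Open Scope quotient_scope.

(** The subgroup of boundaries in degree 2. *)
Definition bound2 : {pred bar_chain gT 2} := fun c => `[< exists b, bar_d b = c >].

Fact bound2_zmod_closed : zmod_closed bound2.
Proof.
split; first by apply/asboolP; exists 0; rewrite raddf0.
move=> c c' /asboolP[b <-] /asboolP[b' <-].
by apply/asboolP; exists (b - b'); rewrite raddfB.
Qed.
HB.instance Definition _ :=
  GRing.isZmodClosed.Build (bar_chain gT 2) bound2 bound2_zmod_closed.

(** The cokernel of the boundary from degree 3 to degree 2. *)
Definition coker3 := Quotient.quot bound2.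
HB.instance Definition _ := GRing.Zmodule.on coker3.

Definition cls2 (c : bar_chain gT 2) : coker3 := \pi_(Quotient.quot bound2) c.

Fact cls2_zmod : zmod_morphism cls2.
Proof. by move=> x y; rewrite /cls2 raddfB. Qed.
HB.instance Definition _ :=
  GRing.isZmodMorphism.Build (bar_chain gT 2) coker3 cls2 cls2_zmod.

Lemma cls2_eq0 c : cls2 c = 0 <-> exists b, bar_d b = c.
Proof.
have -> : cls2 c = 0 <-> c \in bound2.
  rewrite -[c in c \in _]subr0 Quotient.idealrBE -[X in cls2 c = X](raddf0 cls2).
  by split=> [/eqP|/eqP].
by split=> /asboolP.
Qed.

Lemma cls2_surj (a : coker3) : exists c, a = cls2 c.
Proof. by exists (qrepr a); rewrite /cls2 reprK. Qed.

(** The class of [[g|h]] modulo boundaries is the universal 2-cocycle. *)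
Definition univ_cocycle (g h : gT) : coker3 := cls2 (bar2 g h).

Lemma univ_cocycleP g h k :
  univ_cocycle h k + univ_cocycle g (h * k)%g =
  univ_cocycle g h + univ_cocycle (g * h)%g k.
Proof.
apply/eqP; rewrite -subr_eq0 /univ_cocycle -!raddfD -raddfB; apply/eqP/cls2_eq0.
by exists (bar3 g h k); rewrite bar_d3; apply/ffunP=> y; rewrite !ffunE; ring.
Qed.

Lemma coker3_lift (V : zmodType) (f : {additive bar_chain gT 2 -> V}) :
  (forall c, f (bar_d c) = 0) ->
  exists h : {additive coker3 -> V}, forall c, h (cls2 c) = f c.
Proof.
move=> fd; have [|h hE] := @zmod_quot_lift _ _ bound2 f; last by exists h.
by move=> _ /asboolP[b <-]; apply: fd.
Qed.

Lemma coker3_bd : exists d : {additive coker3 -> bar_chain gT 1},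
  forall c, d (cls2 c) = bar_d c.
Proof. exact: (coker3_lift (@bar_dd gT)). Qed.

(** Every 2-cocycle with trivial action is an image of the universal one. *)
Lemma coker3_univ (V : zmodType) (f : gT -> gT -> V) :
  (forall g h k, f h k + f g (h * k)%g = f g h + f (g * h)%g k) ->
  exists F : {additive coker3 -> V}, forall g h, F (univ_cocycle g h) = f g h.
Proof.
move=> fP; have [f0 f0E] := bar_lift (fun x : 2.-tuple gT =>
  f (tnth x ord0) (tnth x (lift ord0 ord0))).
have [|F FE] := @coker3_lift _ f0; last by exists F => g h; rewrite FE f0E.
pose fd : {additive bar_chain gT 3 -> V} := f0 \o @bar_d gT 2.
apply: (bar3_ext (f := fd) (h := \0)) => g h k /=.
rewrite bar_d3 raddfB raddfD raddfB /= !f0E /= !(tnth_nth 1%g) /=.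
by rewrite [_ - _ + f g _]addrAC fP addrK subrr.
Qed.

(** The second homology group is the kernel of the map that the boundary induces
    on the cokernel of the next boundary. *)
Lemma homology2_embed : exists i : {additive homology gT 2 -> coker3},
  injective i /\ forall d : {additive coker3 -> bar_chain gT 1},
    (forall c, d (cls2 c) = bar_d c) -> forall a, d a = 0 <-> exists h, i h = a.
Proof.
pose f : {additive bar_cycle gT 2 -> coker3} := cls2 \o val.
have [|i iE] := @zmod_quot_lift _ _ (@boundary_pred gT 2) f.
  by move=> z /asboolP zb; apply/cls2_eq0.
exists i; split.
  apply: raddf_inj => a; rewrite -[a]reprK iE => /cls2_eq0 ba.
  have <- : \pi_(homology gT 2) 0 = 0 by rewrite raddf0.
  apply/eqP; rewrite -Quotient.idealrBE subr0; exact/asboolP.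
move=> d dE a; have [c ->] := cls2_surj a; rewrite dE; split=> [/eqP dc|[h]].
  by exists (\pi_(homology gT 2) (Sub c dc)); rewrite iE.
rewrite -[h]reprK iE /= -!dE => <-; rewrite dE; apply/eqP; exact: valP (qrepr h).
Qed.

End BarQuotient.

(** * Central extensions by cocycles *)

(** Inhomogeneous 2-cocycles with trivial action; they need not be normalized. *)
Definition cocycle (K : groupType) (B : zmodType) (f : K -> K -> B) : Prop :=
  forall g h k, (f h k + f g (h * k)%g = f g h + f (g * h)%g k)%R.

Section CocycleExtension.
Variables (K : groupType) (B : zmodType) (f : K -> K -> B) (fP : cocycle f).

Lemma cocycle1l g : f 1 g = f 1 1.
Proof. by have := fP 1 1 g; rewrite !mul1g => /addIr. Qed.

Lemma cocycle1r g : f g 1 = f 1 1.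
Proof. by have := fP g 1 1; rewrite !mulg1 => /addIr. Qed.

Lemma cocycleV g : f g g^-1 = f g^-1 g.
Proof.
by have := fP g g^-1 g; rewrite mulVg mulgV cocycle1l cocycle1r => /addIr.
Qed.

(** The central extension of [K] by [B] with cocycle [f], on the set [B * K]. As
    [f] is not normalized, its identity is [(- f 1 1, 1)]. The type depends on the
    cocycle condition, so that the group structure can be found from the type. *)
Definition cext : Type := let _ := fP in (B * K)%type.
HB.instance Definition _ := Choice.on cext.

Definition cext_mul (p q : cext) : cext := ((p.1 + q.1 + f p.2 q.2)%R, p.2 * q.2).
Definition cext_one : cext := ((- f 1 1)%R, 1).
Definition cext_inv (p : cext) : cext :=
  ((- p.1 - f 1 1 - f p.2^-1 p.2)%R, p.2^-1).

Fact cext_mulA : associative cext_mul.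
Proof.
move=> p q r; rewrite /cext_mul /= mulgA; congr (_, _); rewrite !addrA.
by rewrite -[LHS]addrA fP addrA; congr (_ + _)%R; apply: addrAC.
Qed.

Fact cext_mul1 : left_id cext_one cext_mul.
Proof.
by case=> a g; rewrite /cext_mul /= cocycle1l mul1g addrAC addNr add0r.
Qed.

Fact cext_mul1r : right_id cext_one cext_mul.
Proof. by case=> a g; rewrite /cext_mul /= cocycle1r mulg1 subrK. Qed.

Fact cext_mulV : left_inverse cext_one cext_inv cext_mul.
Proof.
case=> a g; rewrite /cext_mul /= mulVg; congr (_, _).
by rewrite addrAC subrK addrAC addNr add0r.
Qed.

Fact cext_mulVr : right_inverse cext_one cext_inv cext_mul.
Proof.
case=> a g; rewrite /cext_mul /= mulgV; congr (_, _).
by rewrite cocycleV addrA subrK addrA subrr add0r.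
Qed.

HB.instance Definition _ := isGroup.Build cext
  cext_mulA cext_mul1 cext_mul1r cext_mulV cext_mulVr.

Lemma cextME (p q : cext) : p * q = ((p.1 + q.1 + f p.2 q.2)%R, p.2 * q.2) :> cext.
Proof. by []. Qed.

Lemma cext1E : 1 = ((- f 1 1)%R, 1) :> cext.
Proof. by []. Qed.

Lemma cext_commute (p q : cext) : p.2 * q.2 = q.2 * p.2 ->
  f p.2 q.2 = f q.2 p.2 -> p * q = q * p.
Proof. by move=> pq fpq; rewrite !cextME pq fpq [(p.1 + _)%R]addrC. Qed.

Lemma cext_central (p q : cext) : p.2 = 1 -> p * q = q * p.
Proof.
by move=> p1; apply: cext_commute; rewrite p1 ?mulg1 ?mul1g // cocycle1l cocycle1r.
Qed.

(** The embedding of [B] as a central subgroup. *)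
Definition cext_in (a : B) : cext := ((a - f 1 1)%R, 1).

Lemma cext_inD a b : cext_in (a + b)%R = cext_in a * cext_in b.
Proof.
rewrite cextME /= mulg1; congr (_, _).
by rewrite -[RHS]addrA subrK addrAC.
Qed.

(** The tautological section, which is not a homomorphism. *)
Definition cext_sec (g : K) : cext := (0%R, g).

Lemma cextE (p : cext) : p = cext_in p.1 * cext_sec p.2.
Proof. by case: p => a g; rewrite cextME /= mul1g addr0 cocycle1l subrK. Qed.

Lemma cext_secM g h : cext_sec g * cext_sec h = cext_in (f g h) * cext_sec (g * h).
Proof. by rewrite !cextME /= mul1g !addr0 add0r cocycle1l subrK. Qed.

End CocycleExtension.

Section Center.
Variable L : groupType.

Definition central_pred : {pred L} := fun x => `[< forall y, x * y = y * x >].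

(** The centre of a group, as an additive group. *)
Definition centerg : Type := {x : L | x \in central_pred}.
HB.instance Definition _ := SubChoice.on centerg.

Definition cval (a : centerg) : L := \val a.

Lemma centergP (a : centerg) y : cval a * y = y * cval a.
Proof. by case: a => x; rewrite /cval /= => /asboolP. Qed.

Fact centerg1_subproof : (1 : L) \in central_pred.
Proof. by apply/asboolP => y; rewrite mulg1 mul1g. Qed.
Fact centergM_subproof (a b : centerg) : cval a * cval b \in central_pred.
Proof. by apply/asboolP => y; rewrite -mulgA (centergP b) mulgA (centergP a y) mulgA. Qed.
Fact centergV_subproof (a : centerg) : (cval a)^-1 \in central_pred.
Proof. by apply/asboolP => y; apply/esym/commuteV/esym/centergP. Qed.

Definition centerg_add (a b : centerg) : centerg :=
  exist (fun x => x \in central_pred) _ (centergM_subproof a b).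
Definition centerg_zero : centerg :=
  exist (fun x => x \in central_pred) _ centerg1_subproof.
Definition centerg_opp (a : centerg) : centerg :=
  exist (fun x => x \in central_pred) _ (centergV_subproof a).

Fact centerg_addA : associative centerg_add.
Proof. by move=> a b c; apply: val_inj; apply: mulgA. Qed.
Fact centerg_addC : commutative centerg_add.
Proof. by move=> a b; apply: val_inj; apply: centergP. Qed.
Fact centerg_add0 : left_id centerg_zero centerg_add.
Proof. by move=> a; apply: val_inj; apply: mul1g. Qed.
Fact centerg_addN : left_inverse centerg_zero centerg_opp centerg_add.
Proof. by move=> a; apply: val_inj; apply: mulVg. Qed.
HB.instance Definition _ := GRing.isZmodule.Build centerg
  centerg_addA centerg_addC centerg_add0 centerg_addN.

Lemma cvalD (a b : centerg) : cval (a + b)%R = cval a * cval b.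
Proof. by []. Qed.

Lemma cval0 : cval 0%R = 1.
Proof. by []. Qed.

Lemma cval_inj : injective cval.
Proof. exact: val_inj. Qed.
End Center.

Section Universal.
Variable gT : finGroupType.

Lemma univ_cocycle_cocycle : cocycle (@univ_cocycle gT).
Proof. exact: univ_cocycleP. Qed.

(** The central extension defined by the universal cocycle. *)
Definition univ_ext := cext univ_cocycle_cocycle.
HB.instance Definition _ := Group.on univ_ext.

Definition univ_sec (g : gT) : univ_ext := cext_sec univ_cocycle_cocycle g.

(** [univ_ext] is universal among the groups [L] with a map [s] out of [gT] that
    is multiplicative up to central elements. *)
Lemma univ_ext_lift (L : groupType) (s : gT -> L) :
  (forall g h y, s g * s h * (s (g * h))^-1 * y = y * (s g * s h * (s (g * h))^-1)) ->
  exists F : {ghom univ_ext -> L}, forall g, F (univ_sec g) = s g.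
Proof.
move=> sZ.
have Zf g h : s g * s h * (s (g * h))^-1 \in @central_pred L by apply/asboolP.
pose f g h : centerg L := exist (fun x => x \in @central_pred L) _ (Zf g h).
have fP : cocycle f.
  move=> g h k; apply: cval_inj; rewrite !cvalD /cval /= -[s g * s (h * k) * _]mulgA.
  by rewrite [LHS]mulgA (sZ h k) !mulgA !mulgVK.
have [F FE] := coker3_univ fP.
pose T (p : univ_ext) : L := cval (F p.1) * s p.2.
have TM : {morph T : p q / p * q}.
  case=> a g [b h]; rewrite cextME /T /= !raddfD !cvalD FE {3}/cval /=.
  rewrite -!mulgA mulVg mulg1; congr (_ * _); rewrite !mulgA; congr (_ * _).
  exact: centergP.
exists (ghom_of TM) => g; by rewrite /= /T /= raddf0 cval0 mul1g.
Qed.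

End Universal.

(** * The universal central extension and the model of tau *)

Lemma coker3_ind (gT : finGroupType) (P : coker3 gT -> Prop) :
    P 0%R -> (forall a b, P a -> P b -> P (a + b)%R) ->
    (forall a, P a -> P (- a)%R) -> (forall g h, P (univ_cocycle g h)) ->
  forall a, P a.
Proof.
move=> P0 PD PN Pu a; have [c ->] := cls2_surj a.
rewrite [c]bar_chainE raddf_sum; elim/big_ind: _ => [//||x _]; first exact: PD.
have Px : P (cls2 (bar x)).
  case/tupleP: x => g x; case/tupleP: x => h x.
  rewrite (_ : [tuple of _] = [tuple g; h]) //; last first.
    by apply/val_inj; rewrite (tuple0 x).
  exact: Pu.
have Pn n : P (cls2 (bar x) *+ n)%R.
  by elim: n => [|n IHn]; rewrite ?mulr0n // mulrS; apply: PD.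
rewrite raddfMz; case: (c x) => n; [exact: Pn | apply: PN; exact: Pn].
Qed.

Section Derived.
Variable G : groupType.

(** The derived subgroup of a possibly infinite group. *)
Definition derg : {pred G} := gengroup (fun t : G => exists x y, t = [~ x, y]).

Fact dergJ x y : x \in derg -> x ^ y \in derg.
Proof.
apply: gengroupJ => {x}_ {}y [a [b ->]].
by exists (a ^ y), (b ^ y); rewrite conjRg.
Qed.
HB.instance Definition _ := GroupClosed.on derg.
HB.instance Definition _ := isConjClosed.Build G derg dergJ.

Lemma dergC (a b : quotg derg) : a * b = b * a.
Proof.
have [x ->] := qproj_surj a; have [y ->] := qproj_surj b.
rewrite -!qprojM; apply/esym/eqP; rewrite qproj_eq invgM.
by apply/gengroupP/genp_in; exists x, y; rewrite /commg /conjg !gnorm.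
Qed.
End Derived.

(** Factors that commute with [a], [b] and each other do not change the
    commutator of [a] and [b]. *)
Lemma commgM_central (G : groupType) (a b k l : G) :
    commute k a -> commute k b -> commute k l -> commute l a -> commute l b ->
  [~ a * k, b * l] = [~ a, b].
Proof.
move=> ka kb kl la lb.
have cR z : commute z a -> commute z b -> commute z [~ a, b].
  by move=> za zb; rewrite /commg /conjg; do ?[apply: commuteM | apply: commuteV].
rewrite commMg !commgM.
have -> : [~ a, l] = 1 by apply/eqP/commgP/commute_sym.
have -> : [~ k, l] = 1 by apply/eqP/commgP.
have -> : [~ k, b] = 1 by apply/eqP/commgP.
rewrite conj1g mul1g !mulg1.
have fixR z : commute z [~ a, b] -> [~ a, b] ^ z = [~ a, b].
  by move=> zR; apply/conjg_fixP/commgP/commute_sym.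
by rewrite !fixR //; apply: cR.
Qed.

Section Model.
Variable gT : finGroupType.

Local Notation E := (univ_ext gT).
Local Notation sE := (@univ_sec gT).
Local Notation u := (@univ_cocycle gT).
Let e0 : coker3 gT := u 1 1.

Let u1l g : u 1 g = e0. Proof. exact: (cocycle1l (@univ_cocycle_cocycle gT)). Qed.
Let u1r g : u g 1 = e0. Proof. exact: (cocycle1r (@univ_cocycle_cocycle gT)). Qed.

(** An element of [univ_ext] lies in the derived subgroup as soon as its image
    under the homomorphism [(a, g) |-> d a + [g]] to the degree 1 chains is zero:
    these chains form a free abelian group, and sending [[g]] to the class of the
    section at [g] gives a retraction onto the abelianization. *)
Lemma univ_ext_der (d : {additive coker3 gT -> bar_chain gT 1}) (e : E) :
  (forall c, d (cls2 c) = bar_d c) -> (d e.1 + bar1 e.2)%R = 0%R -> e \in @derg E.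
Proof.
move=> dE de0; pose V := quotg (@derg E).
have VZ (x : E) : qproj (@derg E) x \in @central_pred V.
  by apply/asboolP => y; apply: dergC.
pose v0 g : centerg V := exist (fun x => x \in @central_pred V) _ (VZ (sE g)).
have [v vE] := bar_lift (fun x : 1.-tuple gT => v0 (tnth x ord0)).
have v1 g : cval (v (bar1 g)) = qproj (@derg E) (sE g) by rewrite vE.
have vin a : qproj (@derg E) (cext_in _ a) = cval (v (d a)).
  elim/coker3_ind: a => [|a b IHa IHb|a IHa|g h].
  - by rewrite !raddf0 /cext_in add0r -cext1E gmulf1.
  - by rewrite cext_inD qprojM !raddfD cvalD IHa IHb.
  - apply: (mulgI (qproj (@derg E) (cext_in _ a))).
    rewrite -qprojM -cext_inD subrr IHa -cvalD -!raddfD subrr !raddf0.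
    by rewrite /cext_in add0r -cext1E gmulf1.
  - apply: (mulIg (qproj (@derg E) (sE (g * h)))).
    rewrite -qprojM -cext_secM qprojM -!v1 -!cvalD -!raddfD dE bar_d2.
    by congr (cval (v _)); apply/ffunP=> y; rewrite !ffunE; ring.
have : qproj (@derg E) e = qproj (@derg E) 1.
  by rewrite [e]cextE qprojM vin -v1 -cvalD -raddfD de0 raddf0 gmulf1.
by move/esym/eqP; rewrite qproj_eq invg1 mul1g.
Qed.

(** On [gT * gT * gT], the universal cocycle of the middle coordinate minus those
    of the outer ones. *)
Definition cocycle3 (p q : gT * gT * gT) : coker3 gT :=
  (u p.1.2 q.1.2 - u p.1.1 q.1.1 - u p.2 q.2)%R.

Lemma cocycle3P : cocycle cocycle3.
Proof.
move=> g h k; rewrite /cocycle3 /=.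
have A (a b c a' b' c' : coker3 gT) :
    (a - b - c + (a' - b' - c') = a + a' - (b + b') - (c + c'))%R.
  by rewrite addrACA -opprD [X in (X - _)%R]addrACA -opprD.
by rewrite !A !univ_cocycleP.
Qed.

(** The central extension of [gT * gT * gT] in which [tau gT] embeds. *)
Definition model := cext cocycle3P.
HB.instance Definition _ := Group.on model.

(** [univ_ext] embeds in the model over the middle coordinate; the shift by
    [e0 + e0] compensates for the lack of normalization. *)
Definition univ_model (e : E) : model := ((e.1 + (e0 + e0))%R, (1, e.2, 1)).

Fact univ_modelM : {morph univ_model : x y / x * y}.
Proof.
case=> a g [b h]; rewrite /univ_model [LHS]/= [RHS]cextME /cocycle3 /=.
rewrite -[(1, g, 1) * _]/(1 * 1, g * h, 1 * 1) !mulg1.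
have A (x y w t : coker3 gT) : (x + y + w + t = x + t + (y + t) + (w - t))%R.
  by rewrite [(x + t + _)%R]addrACA [RHS]addrACA addrK.
by rewrite A -[(u g h - _ - _)%R]addrA -opprD.
Qed.
HB.instance Definition _ :=
  isGroupMorphism.Build E model univ_model (ghom_of_subproof univ_modelM).

Lemma univ_model_inj : injective univ_model.
Proof. by case=> a g [b h] [/addIr -> ->]. Qed.

(** The images of [x] and [x^*] in the model; unlike the section of [univ_ext],
    these maps are homomorphisms, as the cocycles of two coordinates cancel. *)
Definition model_l (x : gT) : model := (e0, (x, x, 1)).
Definition model_r (x : gT) : model := (e0, (1, x, x)).

Fact model_lM : {morph model_l : x y / x * y}.
Proof.
move=> x y; rewrite [RHS]cextME /cocycle3 /= -[(x, x, 1) * _]/(x * y, x * y, 1 * 1) mulg1.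
by rewrite subrr sub0r addrK.
Qed.

Fact model_rM : {morph model_r : x y / x * y}.
Proof.
move=> x y; rewrite [RHS]cextME /cocycle3 /= -[(1, x, x) * _]/(1 * 1, x * y, x * y) mulg1.
by rewrite [(u x y - _ - _)%R]addrAC subrr sub0r addrK.
Qed.
HB.instance Definition _ :=
  isGroupMorphism.Build gT model model_l (ghom_of_subproof model_lM).
HB.instance Definition _ :=
  isGroupMorphism.Build gT model model_r (ghom_of_subproof model_rM).

Lemma model_commute (p q : model) :
    p.2.1.1 = 1 \/ q.2.1.1 = 1 -> p.2.1.2 = 1 \/ q.2.1.2 = 1 ->
    p.2.2 = 1 \/ q.2.2 = 1 -> commute p q.
Proof.
have uC x y : x = 1 \/ y = 1 -> u x y = u y x by case=> ->; rewrite u1l u1r.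
have gC (x y : gT) : x = 1 \/ y = 1 -> x * y = y * x.
  by case=> ->; rewrite mulg1 mul1g.
case: p q => a [[p1 p2] p3] [b [[q1 q2] q3]] /= h1 h2 h3.
apply: cext_commute => /=; first by congr (_, _, _); apply: gC.
by rewrite /cocycle3 /= !(uC _ _ h1, uC _ _ h2, uC _ _ h3).
Qed.

Lemma model_lE x : exists2 k : model, model_l x = univ_model (sE x) * k & k.2 = (x, 1, 1).
Proof.
exists ((univ_model (sE x))^-1 * model_l x); first by rewrite mulVKg.
by rewrite -[LHS]/(1^-1 * x, x^-1 * x, 1^-1 * 1) invg1 !mul1g mulVg.
Qed.

Lemma model_rE x : exists2 k : model, model_r x = univ_model (sE x) * k & k.2 = (1, 1, x).
Proof.
exists ((univ_model (sE x))^-1 * model_r x); first by rewrite mulVKg.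
by rewrite -[LHS]/(1^-1 * 1, x^-1 * x, 1^-1 * x) invg1 !mul1g mulVg.
Qed.

Lemma model_commg x y : [~ model_l x, model_r y] = univ_model [~ sE x, sE y].
Proof.
have [k -> k2] := model_lE x; have [l -> l2] := model_rE y.
rewrite commgM_central ?gmulfR //; apply: model_commute;
  rewrite ?k2 ?l2 /=; by [left|right].
Qed.

Lemma univ_modelJl e z : univ_model e ^ model_l z = univ_model (e ^ sE z).
Proof.
have [k -> k2] := model_lE z; rewrite conjgM -gmulfJ.
apply/conjg_fixP/commgP; apply: model_commute; rewrite ?k2 /=; by [left|right].
Qed.

Lemma univ_modelJr e z : univ_model e ^ model_r z = univ_model (e ^ sE z).
Proof.
have [k -> k2] := model_rE z; rewrite conjgM -gmulfJ.
apply/conjg_fixP/commgP; apply: model_commute; rewrite ?k2 /=; by [left|right].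
Qed.

(** Commutators in a central extension only depend on the projections. *)
Lemma univ_commg (e h : E) : [~ e, h] = [~ sE e.2, sE h.2].
Proof.
rewrite [in LHS](cextE e) [in LHS](cextE h).
have C (a : coker3 gT) (x : E) : commute (cext_in _ a : E) x by apply: cext_central.
by rewrite ![cext_in _ _ * _]C; apply: commgM_central; apply: C.
Qed.

Lemma tau_to_model : exists Phi : {ghom tau gT -> model},
  (forall x, Phi (tl x) = model_l x) /\ (forall x, Phi (tr x) = model_r x).
Proof.
apply: (@tau_lift _ _ model_l model_r) => [x y z|x y z|x].
- by rewrite !model_commg univ_modelJl conjRg; congr (univ_model _); apply: univ_commg.
- by rewrite !model_commg univ_modelJr conjRg; congr (univ_model _); apply: univ_commg.
- by rewrite model_commg commgg gmulf1.
Qed.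

End Model.

(** * The model is faithful *)

Section Iso.
Variable gT : finGroupType.
Local Notation E := (univ_ext gT).
Local Notation Q := (model gT).
Local Notation sE := (@univ_sec gT).
Local Notation u := (@univ_cocycle gT).
Variable Phi : {ghom tau gT -> Q}.
Hypotheses (Phil : forall x, Phi (tl x) = model_l x)
  (Phir : forall x, Phi (tr x) = model_r x).

Lemma model_twedge x y : Phi (twedge x y) = univ_model [~ sE x, sE y].
Proof. by rewrite /twedge gmulfR Phil Phir model_commg. Qed.

(** The map from [tau gT] to the model is injective. Let [L] be as in
    [extsq_embed]; choose a section of [L] over [gT], and let [Th] be the induced
    map from [univ_ext] to [L]. On [[G, G^*]] the map to the model takes values in
    the copy of [univ_ext], and composed with [Th] it is the embedding in [L]. *)
Lemma tau_model_inj : injective Phi.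
Proof.
apply: gmulf_inj => t Phit1.
have [L [pi [j [pi_s jI jR]]]] := extsq_embed gT.
have [s sK] := boolp.choice pi_s.
have piZ l : pi l = 1 -> forall k, l * k = k * l.
  move=> l1 k; apply/commgP/eqP; rewrite jR l1; have <- : j 1 = 1 by apply: gmulf1.
  congr (j _).
  by apply: val_inj; rewrite /= twedge1l.
have [|Th ThE] := @univ_ext_lift gT L s.
  by move=> g h y; apply: piZ; rewrite !gmulfM gmulfV !sK mulgV.
have PhiM m : m \in @ext_square gT ->
    exists (e : E) (Mm : m \in @ext_square gT),
      Phi m = univ_model e /\ j (exist _ m Mm) = Th e.
  move/gengroupP; elim=> {m} [_ [x [y ->]]||m n _ [e [Mm [Pm jm]]] _ [f [Mn [Pn jn]]]
    |m _ [e [Mm [Pm jm]]]].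
  - exists [~ sE x, sE y], (twedge_in x y); rewrite model_twedge; split=> //.
    rewrite gmulfR !ThE jR !sK; congr (j _); exact: val_inj.
  - exists 1, (@gengroup1 _ _); rewrite !gmulf1; split=> //.
    have <- : j 1 = 1 by apply: gmulf1.
    by congr (j _); apply: val_inj.
  - exists (e * f), (gengroup_mulg_closed Mm Mn); rewrite !gmulfM Pm Pn -jm -jn.
    split=> //.
    by rewrite -gmulfM; congr (j _); apply: val_inj.
  - exists e^-1, (gengroup_invg_closed Mm); rewrite !gmulfV Pm -jm; split=> //.
    by rewrite -gmulfV; congr (j _); apply: val_inj.
have [m [x [y [Mm tE]]]] := tau_decomp t.
have [e [Mm' [Pm jm]]] := PhiM m Mm.
have := Phit1; rewrite tE !gmulfM Pm Phil Phir => /(congr1 (fun q : Q => q.2)).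
rewrite [LHS]/= => -[]; rewrite !mul1g !mulg1 => x1 _ y1.
rewrite x1 y1 !gmulf1 !mulg1 in tE *; rewrite tE in Phit1 *.
have e1 : e = 1 by apply: univ_model_inj; rewrite -Pm Phit1 gmulf1.
have : exist _ m Mm' = 1 :> extsq gT by apply: jI; rewrite jm e1 !gmulf1.
by move/(congr1 val).
Qed.

Variable d : {additive coker3 gT -> bar_chain gT 1}.
Hypothesis dE : forall c, d (cls2 c) = bar_d c.

Lemma d_univ g h : d (u g h) = (bar1 h - bar1 (g * h)%g + bar1 g)%R.
Proof. by rewrite dE bar_d2. Qed.

Lemma d_univ1 : d (u 1 1) = bar1 (1 : gT).
Proof. by rewrite d_univ mulg1 subrr add0r. Qed.

(** The chain [d a + [g2] - [g1] - [g3]] depends multiplicatively on the element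
    [(a, (g1, g2, g3))] of the model, and it vanishes on the image of [tau gT]. *)
Lemma tau_model_bd t : (d (Phi t).1 + bar1 (Phi t).2.1.2 =
  bar1 (Phi t).2.1.1 + bar1 (Phi t).2.2)%R.
Proof.
pose F (q : Q) : bar_chain gT 1 :=
  (d q.1 + bar1 q.2.1.2 - (bar1 q.2.1.1 + bar1 q.2.2))%R.
have FM p q : F (p * q) = (F p + F q)%R.
  rewrite cextME /F /= /cocycle3 /= !raddfD !raddfN /= !d_univ.
  by apply/ffunP=> y; rewrite !ffunE; ring.
have F1 : F 1 = 0%R by apply: (addIr (F 1)); rewrite -FM mulg1 add0r.
suff : F (Phi t) = 0%R by move/eqP; rewrite subr_eq0 => /eqP.
elim/tau_ind: t => [|x t IHt|x t IHt]; first by rewrite gmulf1.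
  by rewrite gmulfM FM IHt addr0 Phil /F /= d_univ1 [X in (X - _)%R]addrC subrr.
by rewrite gmulfM FM IHt addr0 Phir /F /= d_univ1 subrr.
Qed.

(** The derived subgroup of [univ_ext] comes from [[G, G^*]]. *)
Lemma tau_model_der (e : E) : e \in @derg E ->
  exists2 m, m \in @ext_square gT & Phi m = univ_model e.
Proof.
move/gengroupP; elim=> {e} [_ [e [f ->]]||e f _ [m Mm Pm] _ [n Mn Pn]|e _ [m Mm Pm]].
- by exists (twedge e.2 f.2); rewrite ?twedge_in // model_twedge -univ_commg.
- by exists 1; rewrite ?gpred1 // !gmulf1.
- by exists (m * n); rewrite ?gpredM // !gmulfM Pm Pn.
- by exists m^-1; rewrite ?gpredV // !gmulfV Pm.
Qed.

Lemma tau_model_cycle (a : coker3 gT) :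
  d a = 0%R -> exists t, Phi t = ((a + u 1 1)%R, (1, 1, 1)).
Proof.
move=> da0; have [|m _ Pm] := @tau_model_der ((a - u 1 1)%R, 1).
  by apply: (univ_ext_der dE); rewrite /= raddfB da0 sub0r d_univ1 addNr.
by exists m; rewrite Pm /univ_model /= addrA subrK.
Qed.

End Iso.

(** * The projection onto K(G,3) *)

Section Projection.
Variable gT : finGroupType.
Local Notation D := [set: gT]^`(1).

Lemma der_abelianC (u v : coset_of D) : u * v = v * u.
Proof.
have [x _ ->] := cosetP u; have [y _ ->] := cosetP v.
by apply: (centsP (der_abelian 0 [set: gT])); rewrite mem_quotient ?inE.
Qed.

Lemma der_norm_setT (x : gT) : x \in 'N(D).
Proof. by rewrite (subsetP (der_norm 1 [set: gT])) ?inE. Qed.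

Lemma coset_derM (x y : gT) : coset D (x * y) = coset D x * coset D y.
Proof. by rewrite morphM ?der_norm_setT. Qed.

Lemma coset_derV (x : gT) : coset D x^-1 = (coset D x)^-1.
Proof. by rewrite morphV ?der_norm_setT. Qed.

Lemma mem_der (x : gT) : (x \in D) = (coset D x == 1).
Proof. by apply/idP/eqP => [/coset_id //|]; apply: coset_idr; apply: der_norm_setT. Qed.

(** The triple [(a, b, c)] as an element of the threefold power of [gT]. *)
Definition triple (a b c : gT) : {dffun forall i : 'I_3, gT} :=
  [ffun i : 'I_3 => nth 1 [:: a; b; c] i : gT].

Lemma triple_KG a b c : (triple a b c \in KG gT 3) = (a * b * c \in D).
Proof. by rewrite inE !big_ord_recl big_ord0 !ffunE /= mulg1 mulgA. Qed.

Lemma tripleM a b c a' b' c' :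
  triple (a * a') (b * b') (c * c') = triple a b c * triple a' b' c'.
Proof. by apply/ffunP => -[[|[|[]]] // ?]; rewrite !ffunE. Qed.

Lemma tripleE (k : {dffun forall i : 'I_3, gT}) : exists a b c, k = triple a b c.
Proof.
exists (k ord0), (k (lift ord0 ord0)), (k (lift ord0 (lift ord0 ord0))).
apply/ffunP => -[[|[|[]]] // ?]; rewrite ffunE /=; congr (k _); exact: val_inj.
Qed.

Lemma triple_inj a b c a' b' c' :
  triple a b c = triple a' b' c' -> [/\ a = a', b = b' & c = c'].
Proof.
move/ffunP=> e; have := e ord0; have := e (lift ord0 ord0).
by have := e (lift ord0 (lift ord0 ord0)); rewrite !ffunE.
Qed.

Lemma triple1 : triple 1 1 1 = 1.
Proof. by apply/ffunP => -[[|[|[]]] // ?]; rewrite !ffunE. Qed.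

End Projection.

Theorem corollary4p4 (gT : finGroupType)
  (hAI : exists f : {perm gT}, AI_automorphism f) :
  exists (i : {multiplicative Algebra.to_multiplicative (homology gT 2) -> tau gT})
         (p : {multiplicative tau gT -> [subg (KG gT 3)]}),
    central_extension i p.
Proof.
have [al [Aal alD]] := hAI.
have [d dE] := coker3_bd gT.
have [h [hI hE]] := homology2_embed gT.
have [Phi [Phil Phir]] := tau_to_model gT.
have PhiI := tau_model_inj Phil Phir.
have alM : {morph al : x y / x * y}.
  by move=> x y; move: Aal; rewrite inE => /andP[_ /morphicP]; apply; rewrite inE.
have al1 : al 1 = 1 by apply: (mulgI (al 1)); rewrite -alM !mulg1.
(* The identity of the model is [(univ_cocycle 1 1, (1, 1, 1))], hence the shift. *)
pose iQ (a : homology gT 2) : model gT := ((h a + univ_cocycle 1 1)%R, (1, 1, 1)).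
have iQ_im a : exists t, Phi t = iQ a.
  by apply: (tau_model_cycle Phil Phir dE); apply/(hE d dE); exists a.
have [i0 i0E] := boolp.choice iQ_im.
have iM : {morph (i0 : Algebra.to_multiplicative (homology gT 2) -> tau gT) :
    x y / x * y}.
  move=> a b; apply: PhiI; rewrite gmulfM !i0E cextME /iQ /= raddfD.
  congr (_, _); last by rewrite -[RHS]/(1 * 1, 1 * 1, 1 * 1) mulg1.
  rewrite /cocycle3 /= subrr sub0r.
  by rewrite addrACA -[RHS]addrA addrK.
(* The image of [tau gT] lies over the triples [(g1, g2, g3)] with [g2 = g1 * g3]
   modulo the derived subgroup; applying the AI-automorphism to [g2] lands in K(G,3). *)
pose p0 (t : tau gT) := triple (Phi t).2.1.1 (al (Phi t).2.1.2) (Phi t).2.2.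
have p0M : {morph p0 : s t / s * t}.
  by move=> s t; rewrite /p0 gmulfM cextME /= alM tripleM.
have p0K t : p0 t \in KG gT 3.
  elim/tau_ind: t => [|x t IHt|x t IHt].
  - by rewrite /p0 gmulf1 /= al1 triple1 group1.
  - rewrite p0M groupM // /p0 Phil /= triple_KG mem_der !coset_derM alD.
    by rewrite mulgV mul1g morph1.
  - rewrite p0M groupM // /p0 Phir /= triple_KG mem_der !coset_derM alD.
    by rewrite morph1 mul1g mulVg.
have pM : {morph (fun t => subg (KG gT 3) (p0 t)) : s t / s * t}.
  by move=> s t; rewrite p0M; apply: (morphM (subg_morphism _)).
(* In the middle coordinate, [[G, G^*]] covers the derived subgroup. *)
have DE w : w \in [set: gT]^`(1) -> exists m, (Phi m).2 = (1, w, 1).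
  pose W := [set w | `[< exists m, (Phi m).2 = (1, w, 1) >]].
  have WG : group_set W.
    apply/group_setP; split=> [|x y]; rewrite ?inE.
      by apply/asboolP; exists 1; rewrite gmulf1.
    move=> /asboolP[m mx] /asboolP[n ny]; apply/asboolP; exists (m * n).
    by rewrite gmulfM cextME /= mx ny -[LHS]/(1 * 1, x * y, 1 * 1) !mulg1.
  suff /subsetP sDW : [set: gT]^`(1) \subset Group WG.
    by move=> /sDW; rewrite inE => /asboolP.
  rewrite derg1 gen_subG; apply/subsetP => _ /imset2P[x y _ _ ->].
  by rewrite inE; apply/asboolP; exists (twedge x y); rewrite model_twedge.
exists (ghom_of iM), (ghom_of pM); split.
- move=> a b /(congr1 Phi) /=; rewrite !i0E => -[]; by move/addIr/hI.
- move=> q; have [a [b [c qE]]] := tripleE (sgval q).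
  have := subgP q; rewrite qE triple_KG mem_der !coset_derM => /eqP abc1.
  have [b' al_b] : exists b', al b' = b by exists (al^-1 b); rewrite permKV.
  have [m mE] : exists m, (Phi m).2 = (1, b' * (a * c)^-1, 1).
    apply: DE; rewrite mem_der coset_derM coset_derV coset_derM.
    rewrite -(invgK (coset _ b')) -alD al_b der_abelianC -invgM -abc1.
    by rewrite mulgA [_ * coset _ a]der_abelianC abc1 invg1.
  exists (m * tl a * tr c); apply: subg_inj; rewrite subgK // qE.
  have PE : (Phi (m * tl a * tr c)).2 = (a, b', c).
    rewrite !gmulfM Phil Phir -[LHS]/((Phi m).2 * (a, a, 1) * (1, c, c)) mE.
    rewrite -[LHS]/(1 * a * 1, b' * (a * c)^-1 * a * c, 1 * 1 * c).
    by rewrite !mul1g mulg1 -mulgA mulgVK.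
  by rewrite /p0 PE /= al_b.
- move=> t; split=> [pt1|[a <-]]; last first.
    by apply: subg_inj; rewrite subgK // /p0 /= i0E /= al1 triple1.
  have /triple_inj[q1 q2 q3] : p0 t = triple 1 1 1.
    by rewrite triple1; have := congr1 sgval pt1; rewrite /= subgK.
  have {}q2 : (Phi t).2.1.2 = 1 by apply: (perm_inj (s := al)); rewrite al1.
  have := tau_model_bd Phil Phir dE t; rewrite q1 q2 q3 => /addIr dt.
  have [|a ha] := (hE d dE ((Phi t).1 - univ_cocycle 1 1)%R).1.
    by rewrite raddfB dt d_univ1 // subrr.
  exists a; apply: PhiI; rewrite /= i0E /iQ ha subrK.
  by case: (Phi t) q1 q2 q3 => x [[x1 x2] x3] /= -> -> ->.
- move=> a t; apply: PhiI; rewrite !gmulfM /= i0E; exact: cext_central.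
Qed.
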